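(* Let $X$ be a proper, geodesic, geodesically complete, boundary continuous Gromov hyperbolic space whose visual boundary $\partial X$ has at least four points. Let $\delta\ge0$ be such that all geodesic triangles in $X$ are $\delta$-thin. Then the image of the visual embedding $i_X:X\to\mathcal{M}(\partial X)$, $x\mapsto\rho_x$, is $7\delta$-dense in $\mathcal{M}(\partial X)$, i.e. for every $\rho\in\mathcal{M}(\partial X)$ there is $x\in X$ with $d_{\mathcal{M}}(\rho,\rho_x)\le7\delta$. Moreover, the visual embedding $i_X$ is an isometry (i.e. a distance-preserving bijection) if and only if $X$ is a maximal Gromov hyperbolic space.
   Context: Antipodal spaces and Moebius spaces. Let $Z$ be a compact metrizable space containing at least four points. A separating function on $Z$ is a continuous function $\rho : Z\times Z\to[0,\infty)$ which is symmetric and satisfies $\rho(\xi,\eta)=0$ if and only if $\xi=\eta$. Its cross-ratio is defined on quadruples of distinct points of $Z$ by $[\xi,\xi',\eta,\eta']_\rho=\frac{\rho(\xi,\eta)\rho(\xi',\eta')}{\rho(\xi,\eta')\rho(\xi',\eta)}$. Two separating functions are Moebius equivalent if their cross-ratios agree. If $\rho_1,\rho_2$ are Moebius equivalent, there is a unique positive continuous function $\frac{d\rho_2}{d\rho_1}:Z\to(0,\infty)$, the derivative, such that $\rho_2(\xi,\eta)^2=\frac{d\rho_2}{d\rho_1}(\xi)\frac{d\rho_2}{d\rho_1}(\eta)\rho_1(\xi,\eta)^2$ for all $\xi,\eta\in Z$. An antipodal function on $Z$ is a separating function $\rho$ such that $\sup_{\xi,\eta}\rho(\xi,\eta)=1$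 and for every $\xi\in Z$ there is $\eta\in Z$ with $\rho(\xi,\eta)=1$. An antipodal space $(Z,\rho_0)$ is such a space $Z$ equipped with an antipodal function $\rho_0$. Its Moebius space $\mathcal{M}(Z)=\mathcal{M}(Z,\rho_0)$ is the set of all antipodal functions on $Z$ Moebius equivalent to $\rho_0$, with the metric $d_{\mathcal{M}}(\rho_1,\rho_2)=\left\|\log\frac{d\rho_2}{d\rho_1}\right\|_\infty$. Boundary continuous Gromov hyperbolic spaces. $(y|z)_x=\frac12(d(x,y)+d(x,z)-d(y,z))$ is the Gromov product. For a proper geodesic Gromov hyperbolic space $X$, $\partial X$ is its visual (Gromov) boundary and $\overline X=X\cup\partial X$ its visual compactification. $X$ is boundary continuous if for each $x\in X$ the Gromov product $(\cdot|\cdot)_x$ extends to a continuous function $\overline X\times\overline X\to[0,+\infty]$; then $\rho_x(\xi,\eta)=e^{-(\xi|\eta)_x}$ for $\xi,\eta\in\partial X$. A space is geodesically complete if every geodesic segment extends to a bi-infinite geodesic. If $X$ is proper, geodesic, geodesically complete and boundary continuous Gromov hyperbolic (with $\partial X$ having at least four points), each $\rho_x$ is an antipodal function on $\partial X$ and all $\rho_x$, $x\in X$, are Moebius equivalent, so $\partial X$ is an antipodal space and $\mathcal{M}(\partial X):=\mathcal{M}(\partial X,\rho_x)$ does not depend on $x$. The visual embedding is $i_X:X\to\mathcal{M}(\partial X)$, $x\mapsto\rho_x$. A map between boundaries is Moebius if it preserves these cross-ratios on quadruples of distinct points. A geodesic triangle is $\delta$-thin if every point on each side is at distance at most $\delta$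 from the union of the other two sides. Maximal Gromov hyperbolic spaces. A proper, geodesic, geodesically complete, boundary continuous Gromov hyperbolic space $X$ is a maximal Gromov hyperbolic space if for every proper, geodesic, geodesically complete, boundary continuous Gromov hyperbolic space $Y$ and every Moebius homeomorphism $g:\partial Y\to\partial X$, there is an isometric (distance-preserving) embedding $G:Y\to X$ extending $g$, meaning that the map $\overline Y\to\overline X$ equal to $G$ on $Y$ and $g$ on $\partial Y$ is continuous. *)

(* Defs.v *)
From HB Require Import structures.
From mathcomp Require Import all_boot all_order all_algebra.
From mathcomp Require Import all_classical all_reals all_analysis.

Set Implicit Arguments.
Unset Strict Implicit.
Unset Printing Implicit Defensive.

Import Order.TTheory GRing.Theory Num.Theory.
Import numFieldNormedType.Exports.

Local Open Scope classical_set_scope.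
Local Open Scope ring_scope.

Section Moebius.
Context {R : realType} {Z : topologicalType}.
Implicit Types rho : Z -> Z -> R.

Definition separating rho :=
  [/\ continuous (fun p : Z * Z => rho p.1 p.2),
      forall xi eta, 0 <= rho xi eta,
      forall xi eta, rho xi eta = rho eta xi &
      forall xi eta, rho xi eta = 0 <-> xi = eta].

Definition cross_ratio rho (xi xi' eta eta' : Z) : R :=
  (rho xi eta * rho xi' eta') / (rho xi eta' * rho xi' eta).

Definition moebius_equiv rho1 rho2 :=
  forall xi xi' eta eta', uniq [:: xi; xi'; eta; eta'] ->
    cross_ratio rho1 xi xi' eta eta' = cross_ratio rho2 xi xi' eta eta'.

(* [sup] is 0 on sets without a supremum, so the second clause also says that
   rho is bounded. *)
Definition antipodal rho :=
  [/\ separating rho,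
      sup (range (fun p : Z * Z => rho p.1 p.2)) = 1 &
      forall xi, exists eta, rho xi eta = 1].

Definition moebius_space rho0 : set (Z -> Z -> R) :=
  [set rho | antipodal rho /\ moebius_equiv rho0 rho].

(* The derivative of rho2 with respect to rho1: for Moebius equivalent
   separating functions on a compact space with at least three points there is
   exactly one such f (otherwise the value 1 is irrelevant). *)
Definition moebius_deriv rho2 rho1 : Z -> R :=
  xget (fun=> 1) [set f : Z -> R |
    [/\ continuous f, forall xi, 0 < f xi &
        forall xi eta, rho2 xi eta ^+ 2 = f xi * f eta * rho1 xi eta ^+ 2]].

Definition moebius_dist rho1 rho2 : R :=
  sup (range (fun xi => `|ln (moebius_deriv rho2 rho1 xi)|)).

End Moebius.

Section Geodesics.
Context {R : realType} {X : metricType R}.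

Definition gromov_product (x y z : X) : R :=
  (mdist x y + mdist x z - mdist y z) / 2.

(* Geodesics are total functions R -> X; only their values on the indicated
   interval matter. *)
Definition isometric_on (I : set R) (c : R -> X) :=
  forall s t, I s -> I t -> mdist (c s) (c t) = `|s - t|.

Definition geodesic_ray (c : R -> X) := isometric_on `[0, +oo[%classic c.

Definition geodesic_line (c : R -> X) := isometric_on setT c.

Definition geodesic_segment (x y : X) (S : set X) :=
  exists c : R -> X, [/\ isometric_on `[0, mdist x y]%classic c,
    c 0 = x, c (mdist x y) = y & S = c @` `[0, mdist x y]%classic].

Definition asymptotic (c c' : R -> X) :=
  exists M : R, forall t, 0 <= t -> mdist (c t) (c' t) <= M.

Definition ray_class (c : R -> X) : set (R -> X) :=
  [set c' | geodesic_ray c' /\ asymptotic c c'].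

Definition within_dist (delta : R) (A B : set X) :=
  forall p, A p -> exists2 q, B q & mdist p q <= delta.

Definition thin_triangle (delta : R) (A B C : set X) :=
  [/\ within_dist delta A (B `|` C), within_dist delta B (C `|` A) &
      within_dist delta C (A `|` B)].

End Geodesics.

Section Spaces.
Context {R : realType}.
Variable X : metricType R.

Definition proper_space :=
  forall (x : X) (r : R), compact [set y | mdist x y <= r].

Definition geodesic_space := forall x y : X, exists S, geodesic_segment x y S.

Definition geodesically_complete :=
  forall (c : R -> X) (l : R), 0 <= l -> isometric_on `[0, l]%classic c ->
    exists2 c' : R -> X, geodesic_line c' &
      forall t, `[0, l]%classic t -> c' t = c t.

Definition all_triangles_thin (delta : R) :=
  forall (x y z : X) (A B C : set X),
    geodesic_segment x y A -> geodesic_segment y z B ->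
    geodesic_segment z x C -> thin_triangle delta A B C.

Definition gromov_hyperbolic :=
  exists2 delta : R, 0 <= delta & all_triangles_thin delta.

(* Points at infinity: classes of asymptotic geodesic rays. *)
Record boundary : Type := Boundary {
  rays_to : set (R -> X);
  boundaryP : exists2 c, geodesic_ray c & rays_to = ray_class c }.

(* The underlying set of the visual compactification of X. *)
Inductive compactification : Type :=
  | Inner of X
  | Ideal of boundary.

HB.instance Definition _ := gen_eqMixin boundary.
HB.instance Definition _ := gen_choiceMixin boundary.
HB.instance Definition _ := gen_eqMixin compactification.
HB.instance Definition _ := gen_choiceMixin compactification.

Definition tends_to (c : R -> X) (z : compactification) : Prop :=
  match z with
  | Inner y => forall t, c t = y
  | Ideal xi => rays_to xi c
  end.

(* Basic neighbourhoods {z | (xi|z)_x >= r} of xi in the visual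
   compactification, where (xi|z)_x is the supremum, over rays c in xi and over
   rays c' in z (c' constant if z is in X), of the lower limit of (c s|c' t)_x
   as s and t go to infinity. Asking for values >= r eventually, rather than in
   the lower limit, changes r by an arbitrarily small amount and hence not the
   topology. *)
Definition ideal_nbhd (x : X) (xi : boundary) (r : R) : set compactification :=
  [set z | exists c c' : R -> X, [/\ tends_to c (Ideal xi), tends_to c' z &
     exists T : R, forall s t, T <= s -> T <= t ->
       r <= gromov_product x (c s) (c' t)]].

Definition compactification_open : set_system compactification :=
  [set U | open (@Inner @^-1` U) /\
     forall xi, U (Ideal xi) -> forall x, exists r, ideal_nbhd x xi r `<=` U].

Lemma compactification_openT : compactification_open setT.
Proof. by split=> [|xi _ x]; [exact: openT | exists 0]. Qed.

Lemma compactification_openI : setI_closed compactification_open.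
Proof.
move=> U V [oU hU] [oV hV]; split; first exact: openI.
move=> xi [/hU {}hU /hV {}hV] x.
have [r hr] := hU x; have [r' hr'] := hV x.
exists (Num.max r r') => z [c [c' [cxi c'z [T hT]]]]; split.
- apply: hr; exists c, c'; split=> //; exists T => s t Ts Tt.
  by apply: le_trans (hT s t Ts Tt); rewrite le_max lexx.
- apply: hr'; exists c, c'; split=> //; exists T => s t Ts Tt.
  by apply: le_trans (hT s t Ts Tt); rewrite le_max lexx orbT.
Qed.

Lemma compactification_open_bigU (I : Type) (f : I -> set compactification) :
  (forall i, compactification_open (f i)) ->
  compactification_open (\bigcup_i f i).
Proof.
move=> of_; split.
  by rewrite preimage_bigcup; apply: bigcup_open => i _; case: (of_ i).
move=> xi [i _ fi] x; have [_ /(_ xi fi x) [r hr]] := of_ i.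
by exists r => z /hr fz; exists i.
Qed.

HB.instance Definition _ := isOpenTopological.Build compactification
  compactification_openT compactification_openI compactification_open_bigU.

HB.instance Definition _ :=
  Topological.copy boundary (initial_topology Ideal).

Definition gromov_extension (x : X)
    (g : compactification * compactification -> \bar R) :=
  [/\ continuous g, forall p, (0 <= g p)%E &
      forall y z, g (Inner y, Inner z) = (gromov_product x y z)%:E].

Definition boundary_continuous := forall x : X, exists g, gromov_extension x g.

(* In a boundary continuous space the extension is unique, as X is dense in its
   compactification. *)
Definition gromov_product_ext (x : X) :
    compactification * compactification -> \bar R :=
  xget (fun=> 0%E) (gromov_extension x).

Definition visual (x : X) (xi eta : boundary) : R :=
  fine (expeR (- gromov_product_ext x (Ideal xi, Ideal eta))%E).

Definition bc_hyperbolic_space :=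
  [/\ proper_space, geodesic_space, geodesically_complete,
      gromov_hyperbolic & boundary_continuous].

End Spaces.

Definition homeomorphism {S T : topologicalType} (f : S -> T) :=
  continuous f /\
  exists h : T -> S, [/\ cancel f h, cancel h f & continuous h].

Section Maximal.
Context {R : realType}.

Definition moebius_map (Y X : metricType R) (g : boundary Y -> boundary X) :=
  forall (y : Y) (x : X) xi xi' eta eta', uniq [:: xi; xi'; eta; eta'] ->
    cross_ratio (visual x) (g xi) (g xi') (g eta) (g eta') =
    cross_ratio (visual y) xi xi' eta eta'.

Definition isometric_embedding (Y X : metricType R) (G : Y -> X) :=
  forall y z, mdist (G y) (G z) = mdist y z.

Definition extended_map (Y X : metricType R) (G : Y -> X)
    (g : boundary Y -> boundary X) (z : compactification Y) :
    compactification X :=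
  match z with
  | Inner y => Inner (G y)
  | Ideal xi => Ideal (g xi)
  end.

Definition maximal_hyperbolic (X : metricType R) :=
  bc_hyperbolic_space X /\
  forall (Y : metricType R) (g : boundary Y -> boundary X),
    bc_hyperbolic_space Y -> homeomorphism g -> moebius_map g ->
    exists2 G : Y -> X, isometric_embedding G & continuous (extended_map G g).

End Maximal.

(* Main.v *)
Require Import Defs.
From HB Require Import structures.
From mathcomp Require Import all_boot all_order all_algebra.
From mathcomp Require Import all_classical all_reals all_analysis.
From mathcomp Require Import lra ring.

Set Implicit Arguments.
Unset Strict Implicit.
Unset Printing Implicit Defensive.

Import Order.TTheory GRing.Theory Num.Theory.
Import numFieldNormedType.Exports.

Local Open Scope classical_set_scope.
Local Open Scope ring_scope.

(** Fix a base point [o] and write [rho] for [visual o]. An antipodal function that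
    is Moebius equivalent to [rho] has the form
    [expR (- (u a + u b) / 2) * rho a b] with [u] continuous, and being antipodal
    means that [2 * ln (rho a b) <= u a + u b] for all [a <> b], with equality for
    some [b] for each [a]. These are the extremal functions of the tight span of the
    distance [2 * ln rho], and the metric of the Moebius space is the sup metric.
    The visual function of [x] corresponds to [u = - busemann o x].

    Density ([visual_dense]). Given [u], take an antipodal pair [a], [b] for it, and
    a point [x] on a geodesic from [a] to [b] with [- busemann o x] equal to [u] at
    [a], hence also at [b]. For any third boundary point [e], one of the sides
    [a, e] and [b, e] of the ideal triangle passes within [delta] of [x], and
    admissibility of [u] on that side gives
    [u e >= - busemann o x e - 2 * delta]. The opposite inequality follows by
    evaluating this one at an antipode of [e].

    An isometric bijective visual embedding makes [X] maximal: a Moebius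
    homeomorphism carries visual functions of [Y] to antipodal functions on the
    boundary of [X], which are visual functions of points of [X]
    ([extension_of_visual]). Busemann functions are determined by visual functions,
    and they determine the distances and the neighbourhoods at infinity.

    For the converse, [visual] is always an isometric embedding, since a Busemann
    function attains its bound at the end of a line, so surjectivity is the point.
    It is deduced from maximality applied to the Moebius space itself, realized as
    [tight_span rho]; this space has to be shown to be proper, geodesic,
    geodesically complete, hyperbolic and boundary continuous, with boundary
    homeomorphic to that of [X] by a Moebius map ([tight_span_bc],
    [end_homeomorphism], [visual_tight_span]).
    - Geodesics, rays and the prolongation of segments come from a nonexpansive
      retraction of the admissible functions onto the extremal ones.
    - Every distance is attained with both signs on an antipodal pair
      ([tight_dist_attained]). This transfers the four-point condition from [rho] to
      the tight span, and it squeezes the Gromov product [(u|v)_w] between values of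
      the function represented by [w] at points lying towards [u] and [v]
      ([rho_le_gromov], [gromov_le_rho]), which gives its limits at infinity.

    Finally let [G] embed the tight span in [X] and extend the identification of the
    boundaries. The Busemann functions of the tight span are the differences
    [u a - v a], so [visual (G u)] is represented by [u] plus a function [k] that
    does not depend on [u]; as [G] maps lines to lines, [k a + k b = 0] for all
    [a <> b], hence [k = 0] ([visual_of_extension]), and [G u] is a preimage of
    [u]. *)

(** * Thin triangles and the four-point condition *)

Section FourPoint.
Context {R : realType} {X : metricType R}.
Implicit Types (x y z w p q : X) (c : R -> X) (k l t : R).
Local Notation d := (@mdist R X).

(** Equivalent to the inequality [(x|z) >= min ((x|y), (y|z)) - k / 2] for Gromov
    products; as a disjunction between sums of distances it feeds linear
    arithmetic directly. *)
Definition four_point k := forall x y z w,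
  d x y + d z w <= d x z + d y w + k \/ d x y + d z w <= d x w + d y z + k.

Lemma segment_between x y S q : geodesic_segment x y S -> S q ->
  [/\ d x q + d q y = d x y, 0 <= d x q & d x q <= d x y].
Proof.
move=> [c [ic c0 cl ->]] [t]; rewrite /= in_itv/= => /andP[t0 tl] <-.
have l0 : 0 <= mdist x y by exact: mdist_ge0.
have I u : 0 <= u <= mdist x y -> `[0, mdist x y]%classic u by rewrite /= in_itv.
have h0 : 0 <= (0 : R) <= mdist x y by rewrite lexx.
have ht : 0 <= t <= mdist x y by rewrite t0.
have hl : 0 <= mdist x y <= mdist x y by rewrite lexx l0.
have e1 := ic 0 t (I _ h0) (I _ ht); have e2 := ic t _ (I _ ht) (I _ hl).
rewrite c0 sub0r normrN ger0_norm// in e1; rewrite cl ler0_norm in e2; last by lra.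
by split; lra.
Qed.

Lemma segment_ends x y S : geodesic_segment x y S -> S x /\ S y.
Proof.
move=> [c [ic c0 cl ->]]; have l0 : 0 <= mdist x y by exact: mdist_ge0.
by split; [exists 0|exists (mdist x y)] => //; rewrite /= in_itv/= l0 lexx.
Qed.

Lemma gromov_product_le_segment x y w S q : geodesic_segment x y S -> S q ->
  gromov_product w x y <= d w q.
Proof.
move=> xyS /(segment_between xyS)[e _ _]; rewrite /gromov_product.
have := metric_triangle w q x; have := metric_triangle w q y.
rewrite (metric_sym q x); lra.
Qed.

(** The distance from [w] to a side [x, y] is the Gromov product [(x|y)_w] up to a
    constant: some point of the side is close to both other sides of the triangle
    [x, y, w], and comparing it with the sides of [x, y, z] gives the condition. *)
Lemma thin_four_point delta : geodesic_space X -> all_triangles_thin X delta ->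
  0 <= delta -> four_point (6 * delta + 4).
Proof.
move=> gX thinX delta0 x y z w.
have [A xyA] := gX x y; have [B ywB] := gX y w; have [C wxC] := gX w x.
have [H _ _] := thinX _ _ _ _ _ _ xyA ywB wxC.
have [[Bw By] [Cw Cx]] := (segment_ends ywB, segment_ends wxC).
have [c [ic c0 cl AE]] := xyA; set l := mdist x y in ic cl AE.
have l0 : 0 <= l by exact: mdist_ge0.
pose E := [set t | 0 <= t <= l /\ exists2 q, C q & d (c t) q <= delta].
have E0 : E 0 by split; [rewrite lexx|exists x; rewrite // c0 mdistxx].
have supE : has_sup E by split; [exists 0|exists l => t [/andP[]]].
have lel : sup E <= l by apply: ge_sup; [exists 0|move=> t [/andP[]]].
(* The supremum need not be attained; times on either side of it are close
   enough, and the slack 1 only enlarges the constant. *)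
have [t1 [t1l [q Cq pq]] t1E] := sup_adherent ltr01 supE.
have t1s : t1 <= sup E by apply: ub_le_sup; [case: supE|split => //; exists q].
have [t2 t2l [t12 [q' Bq' pq']]] : exists2 t2, 0 <= t2 <= l &
    `|t1 - t2| <= 2 /\ exists2 q, B q & d (c t2) q <= delta.
  have [le1|gt1] := leP (sup E + 1) l.
    exists (sup E + 1); first lra.
    split; first by rewrite ler_norml; lra.
    have [|q0 [Bq0|Cq0] q0d] := H (c (sup E + 1)).
    - by rewrite AE; exists (sup E + 1) => //=; rewrite in_itv/=; lra.
    - by exists q0.
    - have : sup E + 1 <= sup E.
        by apply: ub_le_sup; [case: supE|split; [lra|exists q0]].
      lra.
  exists l; first lra.
  split; first by rewrite ler_norml; lra.
  by exists y => //; rewrite cl mdistxx.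
have I t : 0 <= t <= l -> `[0, l]%classic t by rewrite /= in_itv.
have d12 : d (c t1) (c t2) <= 2 by rewrite (ic _ _ (I _ t1l) (I _ t2l)).
have Ap : A (c t1) by rewrite AE; exists t1 => //; exact: I.
have [ep _ _] := segment_between xyA Ap.
have [eq _ _] := segment_between wxC Cq.
have [eq' _ _] := segment_between ywB Bq'.
set p := c t1 in pq d12 Ap ep.
have [D yzD] := gX y z; have [F zxF] := gX z x.
have [/(_ _ Ap)[r DFr pr] _ _] := thinX _ _ _ _ _ _ xyA yzD zxF.
have t1' := metric_triangle w q p; have t2' := metric_triangle w q' p.
have t3 := metric_triangle q' (c t2) p; have t4 := metric_triangle x q p.
have t5 := metric_triangle w p r; have t6 := metric_triangle y q' p.
have s1 := metric_sym q p; have s2 := metric_sym q x; have s3 := metric_sym w q'.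
have s4 := metric_sym (c t2) p; have s5 := metric_sym q' (c t2).
have s6 := metric_sym w x; have s7 := metric_sym p y; have s8 := metric_sym w y.
have s9 := metric_sym w z; have s0 := metric_sym z x.
rewrite -/p in ep; case: DFr => rr.
- right; have := gromov_product_le_segment w yzD rr; rewrite /gromov_product; lra.
- left; have := gromov_product_le_segment w zxF rr; rewrite /gromov_product; lra.
Qed.

(** A point [p] of the side [x, y] has small Gromov product with [z] and one of the
    end points, so it is close to the point of the corresponding side at the same
    distance from that end point. *)
Lemma four_point_thin k : 0 <= k -> four_point k -> all_triangles_thin X (2 * k).
Proof.
move=> k0 H.
have key x y z A B C p : geodesic_segment x y A -> geodesic_segment y z B ->
    geodesic_segment z x C -> A p -> exists2 q, (B `|` C) q & d p q <= 2 * k.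
  move=> xyA [b [ib b0 bl BE]] [c [ic c0 cl CE]] Ap.
  have [ep _ _] := segment_between xyA Ap.
  have yz0 : 0 <= mdist y z by exact: mdist_ge0.
  have zx0 : 0 <= mdist z x by exact: mdist_ge0.
  have s1 := metric_sym x p; have s2 := metric_sym y p; have s3 := metric_sym z x.
  have [h|h] : (d x p + d z p <= d x z + k \/ d y p + d z p <= d y z + k).
    by have [] := H x y z p => ?; [left|right]; lra.
  - pose s := Num.max 0 (d z x - d p x).
    have s0 : 0 <= s by rewrite le_max lexx.
    have sl : s <= d z x by rewrite ge_max zx0 lerBlDr lerDl mdist_ge0.
    have Is : `[0, mdist z x]%classic s by rewrite /= in_itv/= s0 sl.
    have I0 : `[0, mdist z x]%classic 0 by rewrite /= in_itv/= lexx zx0.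
    have Il : `[0, mdist z x]%classic (mdist z x) by rewrite /= in_itv/= lexx zx0.
    exists (c s); first by right; rewrite CE; exists s.
    have e1 := ic _ _ I0 Is; have e2 := ic _ _ Is Il.
    rewrite c0 sub0r normrN ger0_norm// in e1; rewrite cl ler0_norm in e2; last lra.
    have sE : s = 0 /\ d z x <= d p x \/ s = d z x - d p x.
      rewrite /s; case: (leP 0 (d z x - d p x)) => hh; [right|left] => //; split => //; lra.
    have zp0 : 0 <= d z p by exact: mdist_ge0.
    have := H p (c s) x z; rewrite (metric_sym (c s) z) (metric_sym p z).
    by case: sE => [[]|]; case=> *; lra.
  - pose s := Num.min (d y p) (d y z).
    have s0 : 0 <= s by rewrite le_min !mdist_ge0.
    have sl : s <= d y z by rewrite ge_min lexx orbT.
    have Is : `[0, mdist y z]%classic s by rewrite /= in_itv/= s0 sl.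
    have I0 : `[0, mdist y z]%classic 0 by rewrite /= in_itv/= lexx yz0.
    have Il : `[0, mdist y z]%classic (mdist y z) by rewrite /= in_itv/= lexx yz0.
    exists (b s); first by left; rewrite BE; exists s.
    have e1 := ib _ _ I0 Is; have e2 := ib _ _ Is Il.
    rewrite b0 sub0r normrN ger0_norm// in e1; rewrite bl ler0_norm in e2; last lra.
    have sE : s = d y p \/ s = d y z /\ d y z <= d y p.
      by rewrite /s; case: (leP (d y p) (d y z)) => hh; [left|right; split => //; exact: ltW].
    have zp0 : 0 <= d z p by exact: mdist_ge0.
    have := H p (b s) y z; rewrite (metric_sym (b s) y) (metric_sym p z).
    by case: sE => [|[]] ? => [|?]; case=> *; lra.
move=> x y z A B C sA sB sC; split => p Pp.
- exact: key sA sB sC Pp.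
- exact: key sB sC sA Pp.
- exact: key sC sA sB Pp.
Qed.

End FourPoint.

(** * Ultralimits of rays *)

Lemma ultra_fmap (T U : Type) (f : T -> U) (F : set_system T) :
  UltraFilter F -> UltraFilter (f @ F).
Proof.
move=> FU; split=> [|G GP sG]; first exact: fmap_proper_filter.
apply/seteqP; split => // A GA.
have [//|FnA] := in_ultra_setVsetC (f @^-1` A) FU.
have GnA : G (~` A) by exact: sG.
by have /filter_ex [? []] : G (A `&` ~` A) by exact: filterI.
Qed.

Lemma ultra_infty : exists2 U : set_system nat, UltraFilter U & \oo `<=` U.
Proof. by have [U [? ?]] := @ultraFilterLemma _ (\oo : set_system nat) _; exists U. Qed.

Lemma compact_ultra_cvg (T : topologicalType) (A : set T) (I : Type)
    (F : set_system I) (f : I -> T) : compact A -> UltraFilter F ->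
  (\forall i \near F, A (f i)) -> exists2 x, A x & f @ F --> x.
Proof.
rewrite compact_ultra => cA FU FA.
have [x [Ax Fx]] := cA (f @ F) (ultra_fmap f FU) FA.
by exists x.
Qed.

Section Ultralimits.
Context {R : realType} {X : metricType R}.
Implicit Types (x y z : X) (c : R -> X) (r s t : R).
Local Notation d := (@mdist R X).

Lemma mdist_lip2 x y x' y' : `|d x y - d x' y'| <= d x x' + d y y'.
Proof.
have := metric_triangle x x' y; have := metric_triangle x' y' y.
have := metric_triangle x' x y'; have := metric_triangle x y y'.
by rewrite (metric_sym x' x) (metric_sym y' y) ler_norml; lra.
Qed.

Lemma cvg_mdist (I : Type) (F : set_system I) {FF : Filter F} (f h : I -> X) x y :
  f @ F --> x -> h @ F --> y -> d (f i) (h i) @[i --> F] --> d x y.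
Proof.
move=> /metricType_numDomainType.cvgr_dist_lt fx.
move=> /metricType_numDomainType.cvgr_dist_lt hy.
apply/cvgrPdist_le => e e0; have e2 : 0 < e / 2 by lra.
near=> i; apply: le_trans (mdist_lip2 _ _ _ _) _.
suff : d x (f i) < e / 2 /\ d y (h i) < e / 2 by lra.
split; near: i; [exact: fx|exact: hy].
Unshelve. all: by end_near. Qed.

Lemma mdist_cvg_eq (I : Type) (F : set_system I) {FF : ProperFilter F}
    (f : I -> X) x y : f @ F --> x -> f @ F --> y -> x = y.
Proof. by move=> fx fy; exact: (cvg_unique (@metric_hausdorff _ _) fx fy). Qed.

Lemma bounded_ultra_cvg (I : Type) (F : set_system I) (f : I -> X) x r :
  proper_space X -> UltraFilter F -> (\forall i \near F, d x (f i) <= r) ->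
  exists y, f @ F --> y.
Proof.
by move=> pX FU /(compact_ultra_cvg (pX x r) FU)[y _ ?]; exists y.
Qed.

(** Pointwise ultralimits replace the Arzela-Ascoli theorem: isometric paths are
    rigid enough that equality of distances survives a mere pointwise limit. *)
Lemma isometric_ultralimit (I : Type) (F : set_system I) (J : set R)
    (c : I -> R -> X) t0 x r : proper_space X -> UltraFilter F -> J t0 ->
  (\forall i \near F, d x (c i t0) <= r) ->
  (forall s t, J s -> J t -> \forall i \near F, d (c i s) (c i t) = `|s - t|) ->
  exists2 c', isometric_on J c' & forall t, J t -> c^~ t @ F --> c' t.
Proof.
move=> pX FU Jt0 bc ic.
have lim t : {y : X | J t -> c^~ t @ F --> y}.
  apply: cid; have [Jt|nJt] := pselect (J t); last by exists x.
  have [|y cy] := @bounded_ultra_cvg _ F (c^~ t) x (r + `|t0 - t|) pX FU.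
    near=> i; rewrite (le_trans (metric_triangle _ (c i t0) _))// lerD//.
      by near: i.
    by rewrite (near (ic _ _ Jt0 Jt)).
  by exists y.
exists (fun t => sval (lim t)) => [s t Js Jt|t]; last exact: svalP (lim t).
have cs := svalP (lim s) Js; have ct := svalP (lim t) Jt.
have cst : d (c i s) (c i t) @[i --> F] --> d (sval (lim s)) (sval (lim t)).
  exact: cvg_mdist cs ct.
apply/eqP; rewrite eq_le; apply/andP; split.
  by apply: (cvgr_to_le cst); near=> i; rewrite (near (ic _ _ Js Jt)).
by apply: (cvgr_to_ge cst); near=> i; rewrite (near (ic _ _ Js Jt)).
Unshelve. all: by end_near. Qed.

Lemma near_ultra_ger (U : set_system nat) r : \oo `<=` U ->
  \forall n \near U, r <= n%:R.
Proof. by move=> sU; apply: sU; exact: nbhs_infty_ger. Qed.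

Lemma ray_isometric c s t : geodesic_ray c -> 0 <= s -> 0 <= t ->
  d (c s) (c t) = `|s - t|.
Proof. by move=> rc s0 t0; apply: rc; rewrite /= in_itv/= andbT. Qed.

Lemma ray_dist c s t : geodesic_ray c -> 0 <= s -> s <= t ->
  d (c s) (c t) = t - s.
Proof.
move=> rc s0 st; rewrite ray_isometric// ?ler0_norm; lra.
Qed.

Lemma ray_dist_base c x t : geodesic_ray c -> 0 <= t ->
  t - d x (c 0) <= d x (c t) <= t + d x (c 0).
Proof.
move=> rc t0; have := ray_dist rc (lexx 0) t0.
have := metric_triangle x (c 0) (c t); have := metric_triangle (c 0) x (c t).
rewrite (metric_sym (c 0) x); lra.
Qed.

(** The segments of the ray extend to lines, and an ultralimit of these lines keeps
    the ray, although no single one of them need contain it. *)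
Lemma ray_to_line c : proper_space X -> geodesically_complete X ->
  geodesic_ray c -> exists2 l, geodesic_line l & forall t, 0 <= t -> l t = c t.
Proof.
move=> pX cX rc; have [U UU sU] := ultra_infty.
have ext (n : nat) : {l : R -> X | geodesic_line l /\ forall t, 0 <= t <= n%:R -> l t = c t}.
  apply: cid; have [|l ll lE] := cX c n%:R (ler0n _ n).
    by move=> s t; rewrite /= !in_itv/= => /andP[s0 _] /andP[t0 _]; exact: ray_isometric.
  by exists l; split => // t tn; apply: lE; rewrite /= in_itv.
pose l n := sval (ext n).
have lE t : 0 <= t -> \forall n \near U, l n t = c t.
  move=> t0; near=> n; have [_] := svalP (ext n); apply; rewrite t0/=.
  by near: n; exact: near_ultra_ger.
have [||l' il' lim] := @isometric_ultralimit _ U setT l 0 (c 0) 0 pX UU I.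
- by near=> n; rewrite (near (lE _ (lexx 0)))// mdistxx.
- by move=> s t _ _; near=> n; have [+ _] := svalP (ext n); apply.
exists l' => // t t0; apply: (@mdist_cvg_eq _ U _ (l^~ t)); first exact: lim.
by apply: cvg_near_cst; exact: lE.
Unshelve. all: by end_near. Qed.

(** The ultralimit of the segments from [x] to [c n] stays at bounded distance from
    [c] by the four-point condition. *)
Lemma ray_from_point k c x : proper_space X -> geodesic_space X ->
  four_point (X := X) k -> geodesic_ray c ->
  exists c', [/\ geodesic_ray c', c' 0 = x & asymptotic c' c].
Proof.
move=> pX gX H rc; have [U UU sU] := ultra_infty.
have seg (n : nat) : {l : R -> X | [/\ isometric_on `[0, d x (c n%:R)]%classic l,
    l 0 = x & l (d x (c n%:R)) = c n%:R]}.
  by apply: cid; have [S [l [? ? ? _]]] := gX x (c n%:R); exists l.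
pose l n := sval (seg n).
have dl t : \forall n \near U, t <= d x (c n%:R).
  near=> n; have := ray_dist_base x rc (ler0n _ n).
  by have : t + d x (c 0) <= n%:R; [near: n; exact: near_ultra_ger|lra].
have [|||c' rc' lim] := @isometric_ultralimit _ U `[0, +oo[%classic l 0 x 0 pX UU.
- by rewrite /= in_itv/= lexx.
- by near=> n; have [_ + _] := svalP (seg n); rewrite /l => ->; rewrite mdistxx.
- move=> s t; rewrite /= !in_itv/= !andbT => s0 t0; near=> n.
  have [+ _ _] := svalP (seg n); apply; rewrite /= in_itv/=.
    by rewrite s0/=; near: n.
  by rewrite t0/=; near: n.
have I0 t : 0 <= t -> `[0, +oo[%classic t by move=> t0; rewrite /= in_itv/= t0.
exists c'; split => //.
  apply: (@mdist_cvg_eq _ U _ (l^~ 0)); first exact/lim/I0.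
  by apply: cvg_near_cst; near=> n; have [] := svalP (seg n).
exists (d x (c 0) + k) => t t0.
apply: (cvgr_to_le (cvg_mdist (lim _ (I0 _ t0)) (cvg_cst (c t)))).
near=> n; have [il l0 ll] := svalP (seg n).
have tl : t <= d x (c n%:R) by near: n.
have tn : t <= n%:R by near: n; exact: near_ultra_ger.
have J u : 0 <= u <= d x (c n%:R) -> `[0, d x (c n%:R)]%classic u by rewrite /= in_itv.
have h0 : 0 <= (0 : R) <= d x (c n%:R) by rewrite lexx mdist_ge0.
have ht : 0 <= t <= d x (c n%:R) by rewrite t0.
have hl : 0 <= d x (c n%:R) <= d x (c n%:R) by rewrite lexx mdist_ge0.
have e1 := il _ _ (J _ h0) (J _ ht); have e2 := il _ _ (J _ ht) (J _ hl).
rewrite l0 sub0r normrN ger0_norm// in e1; rewrite ll ler0_norm in e2; last by lra.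
have b1 := ray_dist_base x rc t0; have b2 := ray_dist_base x rc (ler0n _ n).
have e3 := ray_dist rc t0 tn.
rewrite -/(l n) in e1 e2 *; have s1 := metric_sym x (l n t).
have := H (l n t) (c t) x (c n%:R); rewrite (metric_sym (c t) x).
by case; lra.
Unshelve. all: by end_near. Qed.

End Ultralimits.

(** * Gromov products and boundary points *)

Section Products.
Context {R : realType} {X : metricType R}.
Implicit Types (x y z w : X) (c : R -> X) (k r s t : R).
Local Notation d := (@mdist R X).

Lemma gromov_productC w x y : gromov_product w x y = gromov_product w y x.
Proof. by rewrite /gromov_product (metric_sym x y) [X in X - _]addrC. Qed.

Lemma gromov_product_ge0 w x y : 0 <= gromov_product w x y.
Proof.
have := metric_triangle x w y; rewrite /gromov_product (metric_sym x w); lra.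
Qed.

Lemma gromov_product_le w x y : gromov_product w x y <= d w x.
Proof. by have := metric_triangle w x y; rewrite /gromov_product; lra. Qed.

Lemma gromov_product_lip w x y y' :
  `|gromov_product w x y - gromov_product w x y'| <= d y y'.
Proof.
have := mdist_lip2 w y w y'; have := mdist_lip2 x y x y'.
by rewrite !mdistxx /gromov_product !ler_norml; lra.
Qed.

Lemma gromov_product_base w w' x y :
  `|gromov_product w x y - gromov_product w' x y| <= d w w'.
Proof.
have := mdist_lip2 w x w' x; have := mdist_lip2 w y w' y.
by rewrite !mdistxx /gromov_product !ler_norml; lra.
Qed.

Lemma four_point_gromov k w x y z : four_point (X := X) k ->
  gromov_product w x z >= gromov_product w x y - k / 2 \/
  gromov_product w x z >= gromov_product w z y - k / 2.
Proof.
move=> H; have := H x z w y; rewrite /gromov_product.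
rewrite (metric_sym x w) (metric_sym z w).
by case=> h; [right|left]; lra.
Qed.

Lemma gromov_product_rays w c c' r : geodesic_ray c -> geodesic_ray c' ->
  asymptotic c c' -> exists T, forall s t, T <= s -> T <= t ->
    r <= gromov_product w (c s) (c' t).
Proof.
move=> rc rc' [M cM].
pose A := Num.max 0 ((d w (c 0) + d w (c' 0) + M + 2 * r) / 2).
have A0 : 0 <= A by rewrite le_max lexx.
have Ar : (d w (c 0) + d w (c' 0) + M + 2 * r) / 2 <= A by rewrite le_max lexx orbT.
exists A => s t As At; have s0 := le_trans A0 As; have t0 := le_trans A0 At.
have := cM _ A0; have := ray_dist_base w rc s0; have := ray_dist_base w rc' t0.
have := ray_dist rc A0 As; have := ray_dist rc' A0 At.
have := metric_triangle (c s) (c A) (c' t).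
have := metric_triangle (c A) (c' A) (c' t).
by rewrite /gromov_product (metric_sym (c s) (c A)); lra.
Qed.

(** Two applications of the four-point condition move the bound from the far points
    [c s] and [c' t] to the points [c a] and [c' a]. *)
Lemma asymptotic_of_gromov k w c c' : four_point (X := X) k ->
  geodesic_ray c -> geodesic_ray c' ->
  (forall a r, exists s t, [/\ a <= s, a <= t & r <= gromov_product w (c s) (c' t)]) ->
  asymptotic c c'.
Proof.
move=> H rc rc' hG; exists (d w (c 0) + d w (c' 0) + 2 * `|k|) => a a0.
have [s [t [as_ at_ G]]] := hG a (a + d w (c 0) + d w (c' 0)).
have s0 := le_trans a0 as_; have t0 := le_trans a0 at_.
have b1 := ray_dist_base w rc a0; have b2 := ray_dist_base w rc' a0.
have b3 := ray_dist_base w rc s0; have b4 := ray_dist_base w rc' t0.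
have e1 := ray_dist rc a0 as_; have e2 := ray_dist rc' a0 at_.
have n0 : 0 <= d w (c 0) by exact: mdist_ge0.
have n1 : 0 <= d w (c' 0) by exact: mdist_ge0.
have kk : k <= `|k| by exact: ler_norm.
have k0 : 0 <= `|k| by [].
rewrite /gromov_product in G.
have s1 := metric_sym w (c a); have s2 := metric_sym w (c' t).
have s3 := metric_sym w (c s); have s4 := metric_sym (c' t) (c s).
have s5 := metric_sym w (c' a); have s6 := metric_sym (c' a) (c' t).
have h1 : d (c a) (c' t) <= d w (c' t) - a + d w (c 0) + `|k|.
  by have := H (c a) (c' t) w (c s); case; lra.
by have := H (c a) (c' a) w (c' t); case; lra.
Qed.

Lemma asymptotic_refl c : asymptotic c c.
Proof. by exists 0 => t _; rewrite mdistxx. Qed.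

Lemma asymptotic_sym c c' : asymptotic c c' -> asymptotic c' c.
Proof. by move=> [M h]; exists M => t t0; rewrite metric_sym; exact: h. Qed.

Lemma asymptotic_trans c1 c2 c3 :
  asymptotic c1 c2 -> asymptotic c2 c3 -> asymptotic c1 c3.
Proof.
move=> [M h] [N h']; exists (M + N) => t t0.
by rewrite (le_trans (metric_triangle _ (c2 t) _))// lerD ?h ?h'.
Qed.

Lemma rays_to_ray (a : boundary X) c : rays_to a c -> geodesic_ray c.
Proof. by case: a => S [c0 r0 SE] /=; rewrite SE => -[]. Qed.

Lemma rays_to_ex (a : boundary X) : exists c, rays_to a c.
Proof.
case: a => S [c0 r0 SE]; exists c0; rewrite /= SE; split => //.
exact: asymptotic_refl.
Qed.

Lemma rays_to_asymptotic (a : boundary X) c c' :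
  rays_to a c -> rays_to a c' -> asymptotic c c'.
Proof.
case: a => S [c0 r0 SE] /=; rewrite SE => -[_ h] [_ h'].
exact: asymptotic_trans (asymptotic_sym h) h'.
Qed.

Lemma rays_to_trans (a : boundary X) c c' :
  rays_to a c -> geodesic_ray c' -> asymptotic c c' -> rays_to a c'.
Proof.
case: a => S [c0 r0 SE] /=; rewrite SE => -[_ h] r' h'.
by split => //; exact: asymptotic_trans h h'.
Qed.

Lemma rays_to_eq (a b : boundary X) c c' :
  rays_to a c -> rays_to b c' -> asymptotic c c' -> a = b.
Proof.
move=> ac bc' cc'.
have ab : rays_to a = rays_to b.
  apply/seteqP; split => e ae.
    apply: rays_to_trans bc' (rays_to_ray ae) _.
    exact: asymptotic_trans (asymptotic_sym cc') (rays_to_asymptotic ac ae).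
  apply: rays_to_trans ac (rays_to_ray ae) _.
  exact: asymptotic_trans cc' (rays_to_asymptotic bc' ae).
case: a b ab {ac bc'} => S pS [S' pS'] /= SS'; move: pS pS'.
by rewrite SS' => pS pS'; rewrite (Prop_irrelevance pS pS').
Qed.

Lemma boundary_of_ray c : geodesic_ray c -> exists a : boundary X, rays_to a c.
Proof.
move=> rc; have h : exists2 c', geodesic_ray c' & ray_class c = ray_class c' by exists c.
by exists (Boundary h); split => //; exact: asymptotic_refl.
Qed.

End Products.

(** * The visual compactification *)

Section Compactification.
Context {R : realType} {X : metricType R}.
Implicit Types (x y z w : X) (c : R -> X) (k r s t : R) (a b : boundary X).
Local Notation d := (@mdist R X).
Local Notation cX := (compactification X).

Lemma ideal_nbhd_base x y a r : ideal_nbhd x a (r + d x y) `<=` ideal_nbhd y a r.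
Proof.
move=> z [c [c' [ac c'z [T hT]]]]; exists c, c'; split=> //; exists T => s t sT tT.
have := hT s t sT tT; have := gromov_product_base x y (c s) (c' t).
by rewrite ler_norml; lra.
Qed.

Lemma ideal_nbhd_center x a r : ideal_nbhd x a r (Ideal a).
Proof.
have [c ac] := rays_to_ex a; exists c, c; split => //.
by apply: gromov_product_rays; [exact: rays_to_ray ac..|exact: asymptotic_refl].
Qed.

Lemma compactification_continuous (T : topologicalType) (f : cX -> T) :
  continuous (f \o @Inner R X) ->
  (forall a B, nbhs (f (Ideal a)) B -> exists x r, ideal_nbhd x a r `<=` f @^-1` B) ->
  continuous f.
Proof.
move=> fi fa; apply/continuousP => B oB; split.
  by have /continuousP := fi; apply.
move=> a Ba x; have [|y [r yr]] := fa a B; first exact: open_nbhs_nbhs.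
exists (r + d x y); exact: subset_trans (@ideal_nbhd_base _ _ _ _) yr.
Qed.

Lemma Inner_continuous : continuous (@Inner R X).
Proof. by apply/continuousP => U [oU _]. Qed.

Lemma ray_cvg a c : rays_to a c -> Inner (c t) @[t --> +oo] --> (Ideal a : cX).
Proof.
move=> ac B /=; rewrite nbhsE => -[U [[_ oU] Ua] UB].
have [r hr] := oU a Ua (c 0).
have rc := rays_to_ray ac.
have [T hT] := gromov_product_rays (c 0) r rc rc (asymptotic_refl c).
suff : \forall t \near +oo, B (Inner (c t)) by [].
near=> t; apply/UB/hr; exists c, (fun=> c t); split => //; exists T => s _ sT _.
by apply: hT.
Unshelve. all: by end_near. Qed.

Lemma boundary_ideal_continuous : continuous (@Ideal R X).
Proof. exact: initial_continuous. Qed.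

(** The topology only asks each open set to contain some [ideal_nbhd] at each of its
    ideal points; that these sets are themselves neighbourhoods is where
    hyperbolicity enters, through the quasi-ultrametric inequality for Gromov
    products. *)
Lemma nbhs_ideal_nbhd k x a r : four_point (X := X) k ->
  nbhs (Ideal a : cX) (ideal_nbhd x a r).
Proof.
move=> H; set N := ideal_nbhd x a r.
pose V := [set z : cX | match z with
  | Inner y => interior (@Inner R X @^-1` N) y
  | Ideal b => exists r', ideal_nbhd x b r' `<=` N end].
rewrite nbhsE; exists V; last first.
  case=> [y|b]; first exact: interior_subset.
  by move=> [r']; apply; exact: ideal_nbhd_center.
split; last by exists r.
split; first exact: open_interior.
move=> b [r' r'N] x'; pose q := r' + `|k| + 1.
have k1 : k <= `|k| by exact: ler_norm.
have k0 : 0 <= `|k| by [].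
exists (q + d x' x) => z /ideal_nbhd_base [e [e1 [be e1z [T hT]]]].
case: z e1z => [y|b'] /= e1z.
  apply/nbhs_ballP; exists 1 => //= y'; rewrite ballEmdist /= => yy'.
  apply: r'N; exists e, (fun=> y'); split => //; exists T => s t sT tT.
  have := hT s t sT tT; rewrite e1z.
  by have := gromov_product_lip x (e s) y y'; rewrite ler_norml /q; lra.
exists q => z [c1 [c' [b'c c'z [T' hT']]]].
apply: r'N; exists e, c'; split => //.
have [T2 hT2] := gromov_product_rays x q (rays_to_ray e1z) (rays_to_ray b'c)
  (rays_to_asymptotic e1z b'c).
pose u := Num.max (Num.max T T') T2.
have uT : T <= u by rewrite !le_max lexx.
have uT' : T' <= u by rewrite !le_max lexx orbT.
have uT2 : T2 <= u by rewrite !le_max lexx orbT.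
exists u => s t us ut.
have h1 := hT s u (le_trans uT us) uT.
have h2 := hT2 u u uT2 uT2.
have h3 := hT' u t uT' (le_trans uT' ut).
have h4 : q - k / 2 <= gromov_product x (e s) (c1 u).
  have := four_point_gromov x (e s) (e1 u) (c1 u) H.
  by rewrite (gromov_productC _ (c1 u)); case; lra.
have := four_point_gromov x (e s) (c1 u) (c' t) H; rewrite (gromov_productC _ (c' t) (c1 u)).
by rewrite /q in h1 h2 h3 h4 *; case; lra.
Qed.

End Compactification.

Section BoundaryContinuous.
Context {R : realType} {X : metricType R}.
Implicit Types (x y z w : X) (c : R -> X) (k r s t : R) (a b : boundary X).
Local Notation d := (@mdist R X).
Local Notation cX := (compactification X).
Local Notation gp := gromov_product.
Hypothesis bcX : boundary_continuous X.

Local Notation G := gromov_product_ext.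

Lemma gromov_product_extP x : gromov_extension x (G x).
Proof.
rewrite /gromov_product_ext; case: xgetP => // h.
by have [g /h] := bcX x.
Qed.

Lemma gromov_extension_cvg2 x g a b c c' : gromov_extension x g ->
  rays_to a c -> rays_to b c' ->
  (gp x (c p.1) (c' p.2))%:E @[p --> (+oo, +oo)] --> g (Ideal a, Ideal b).
Proof.
move=> [cg _ gi] ac bc.
under eq_fun do rewrite -gi.
have h : (Inner (c p.1), Inner (c' p.2)) @[p --> (+oo, +oo)] --> (Ideal a : cX, Ideal b : cX).
  apply: (@cvg_pair _ _ _ _ (nbhs (Ideal a : cX)) (nbhs (Ideal b : cX))).
    exact: (cvg_comp _ _ cvg_fst (ray_cvg ac)).
  exact: (cvg_comp _ _ cvg_snd (ray_cvg bc)).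
exact: (cvg_comp _ _ h (cg _)).
Qed.

Lemma gromov_extension_cvg x g a b c c' : gromov_extension x g ->
  rays_to a c -> rays_to b c' ->
  (gp x (c t) (c' t))%:E @[t --> +oo] --> g (Ideal a, Ideal b).
Proof.
move=> [cg _ gi] ac bc.
under eq_fun do rewrite -gi.
have h : (Inner (c t), Inner (c' t)) @[t --> +oo] --> (Ideal a : cX, Ideal b : cX).
  exact: (@cvg_pair _ _ _ _ (nbhs (Ideal a : cX)) (nbhs (Ideal b : cX)) _ _ _ _ _
    (ray_cvg ac) (ray_cvg bc)).
exact: (cvg_comp _ _ h (cg _)).
Qed.

Lemma gromov_extension_cvg1 x g y b c : gromov_extension x g -> rays_to b c ->
  (gp x y (c t))%:E @[t --> +oo] --> g (Inner y, Ideal b).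
Proof.
move=> [cg _ gi] bc.
under eq_fun do rewrite -gi.
have h : (Inner y, Inner (c t)) @[t --> +oo] --> (Inner y : cX, Ideal b : cX).
  apply: (@cvg_pair _ _ _ _ (nbhs (Inner y : cX)) (nbhs (Ideal b : cX))).
    exact: cvg_cst.
  exact: ray_cvg bc.
exact: (cvg_comp _ _ h (cg _)).
Qed.

(** Real-valued even where the Gromov product is infinite, so that limits of
    visual functions need no separate treatment of coinciding boundary points. *)
Definition expNe (e : \bar R) : R := fine (expeR (- e)%E).

Lemma cvg_expNe (I : Type) (F : set_system I) {FF : Filter F} (f : I -> \bar R) l :
  (0 <= l)%E -> f @ F --> l -> expNe (f i) @[i --> F] --> expNe l.
Proof.
case: l => [l| |//] l0 fl.
  have /fine_cvgP [fin fr] := fl.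
  have : expR (- fine (f i)) @[i --> F] --> expR (- l).
    by apply: continuous_cvg; [exact: continuous_expR|exact: cvgN].
  apply: cvg_trans; apply: near_eq_cvg; near=> i.
  have : f i \is a fin_num by near: i.
  by case: (f i).
rewrite /expNe /=; apply/cvgrPdist_le => e e0; near=> i.
have : ((- ln e)%:E <= f i)%E by near: i; exact: cvgey_ge.
case: (f i) => [r| |] /=; rewrite sub0r normrN.
- rewrite lee_fin => er; rewrite ger0_norm ?expR_ge0// -[leRHS]lnK ?posrE// ler_expR; lra.
- by move=> _; rewrite normr0 ltW.
- by move=> _; rewrite normr0 ltW.
Unshelve. all: by end_near. Qed.

Lemma visual_cvg x a b c c' : rays_to a c -> rays_to b c' ->
  expR (- gp x (c t) (c' t)) @[t --> +oo] --> visual x a b.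
Proof.
move=> ac bc; have gx := gromov_product_extP x; have [_ g0 _] := gx.
exact: (cvg_expNe (g0 _) (gromov_extension_cvg gx ac bc)).
Qed.

Lemma visual_continuous x : continuous (fun p => visual x p.1 p.2 : R).
Proof.
move=> [a b]; have [cg g0 _] := gromov_product_extP x.
apply: (cvg_expNe (f := fun p => G x (Ideal p.1, Ideal p.2)) (g0 _)).
have h : (Ideal p.1, Ideal p.2) @[p --> (a, b)] --> (Ideal a : cX, Ideal b : cX).
  apply: (@cvg_pair _ _ _ _ (nbhs (Ideal a : cX)) (nbhs (Ideal b : cX))).
    exact: (cvg_comp (@fst (boundary X) (boundary X)) (@Ideal R X)
      (@cvg_fst _ _ (nbhs a) (nbhs b) _) (@boundary_ideal_continuous _ _ a)).
  exact: (cvg_comp (@snd (boundary X) (boundary X)) (@Ideal R X)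
    (@cvg_snd _ _ (nbhs a) (nbhs b) _) (@boundary_ideal_continuous _ _ b)).
exact: (cvg_comp _ _ h (cg _)).
Qed.

Lemma visual_le_gromov x a b r :
  visual x a b < expR (- r) -> ideal_nbhd x a r (Ideal b).
Proof.
move=> vr; have [c ac] := rays_to_ex a; have [c' bc'] := rays_to_ex b.
exists c, c'; split => //.
have gx := gromov_product_extP x; have [_ g0 _] := gx.
have h := cvgr_lt _ (cvg_expNe (g0 _) (gromov_extension_cvg2 gx ac bc')) _ vr.
have {h} [[A B] /= [[T [_ hT]] [T' [_ hT']]] AB] := h.
exists (Num.max T T' + 1) => s t sT tT.
have T1 : T <= Num.max T T' by rewrite le_max lexx.
have T2 : T' <= Num.max T T' by rewrite le_max lexx orbT.
have := AB (s, t); rewrite /expNe /= ltr_expR ltrN2 => h.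
by apply/ltW/h; split => /=; [apply: hT|apply: hT']; lra.
Qed.

End BoundaryContinuous.

Arguments visual_cvg {R X} bcX x {a b c c'}.

(** * Busemann functions and visual functions *)

(** The neighbourhood filter of a boundary point is inferred in this unfolded form. *)
#[local] Instance boundary_nbhs_filter (R : realType) (X : metricType R) (a : boundary X) :
  Filter (nbhs_of_open (T := initial_topology (@Ideal R X)) _ a) := nbhs_filter a.

Lemma real_cvg_eq (R : realType) (I : Type) (F : set_system I) {FF : ProperFilter F}
    (f : I -> R) (l l' : R) : f @ F --> l -> f @ F --> l' -> l = l'.
Proof. by move=> fl fl'; exact: (cvg_unique (@Rhausdorff R) fl fl'). Qed.

Section Visual.
Context {R : realType} {X : metricType R}.
Implicit Types (x y z w : X) (c : R -> X) (k r s t : R) (a b : boundary X).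
Local Notation d := (@mdist R X).
Local Notation cX := (compactification X).
Local Notation gp := gromov_product.
Hypothesis bcX : boundary_continuous X.

Local Notation G := gromov_product_ext.

(** The Busemann function of [a], as the limit of [d x z - d y z] for [z] tending
    to [a]; it is read off the extended Gromov product so that its continuity in
    [a] is inherited. *)
Definition busemann x y a : R := 2 * fine (G x (Inner y, Ideal a)) - d x y.

Lemma gromov_ext_inner_fin x y a :
  exists2 l : R, G x (Inner y, Ideal a) = l%:E &
    forall c, rays_to a c -> gp x y (c t) @[t --> +oo] --> l.
Proof.
have gx := gromov_product_extP bcX x; have [_ g0 _] := gx.
have cv c : rays_to a c -> (gp x y (c t))%:E @[t --> +oo] --> G x (Inner y, Ideal a).
  by move=> ac; exact: gromov_extension_cvg1 gx ac.
have [c ac] := rays_to_ex a.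
have := g0 (Inner y, Ideal a); move: cv; case: (G x _) => [l| |] //= cv _.
  by exists l => // c' ac'; exact: fine_cvg (cv _ ac').
have /filter_ex [t] : \forall t \near +oo, ((d x y + 1)%:E <= (gp x y (c t))%:E)%E.
  exact: cvgey_ge (cv _ ac) _.
by rewrite /= lee_fin; have := gromov_product_le x y (c t); lra.
Qed.

Lemma busemann_cvg x y a c : rays_to a c ->
  d x (c t) - d y (c t) @[t --> +oo] --> busemann x y a.
Proof.
move=> ac; have [l e lc] := gromov_ext_inner_fin x y a.
rewrite /busemann e /=.
have : 2 * gp x y (c t) - d x y @[t --> +oo] --> 2 * l - d x y.
  by apply: cvgB; [apply: cvgMl_tmp; exact: lc|exact: cvg_cst].
apply: cvg_trans; apply: near_eq_cvg; near=> t.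
by rewrite /gromov_product; field.
Unshelve. all: by end_near. Qed.

Arguments busemann_cvg x y {a c}.

Lemma busemann_continuous x y : continuous (busemann x y).
Proof.
move=> a; have [cg _ _] := gromov_product_extP bcX x.
have [l e _] := gromov_ext_inner_fin x y a.
have h : (Inner y, Ideal b) @[b --> a] --> (Inner y : cX, Ideal a : cX).
  apply: (@cvg_pair _ _ _ _ (nbhs (Inner y : cX)) (nbhs (Ideal a : cX))).
    exact: cvg_cst.
  exact: boundary_ideal_continuous.
have hf : fine (G x (Inner y, Ideal b)) @[b --> a] --> l.
  have hG : G x (Inner y, Ideal b) @[b --> a] --> l%:E.
    by rewrite -e; exact: (cvg_comp _ _ h (cg _)).
  exact: (fine_cvg hG).
have hg : 2 * fine (G x (Inner y, Ideal b)) - d x y @[b --> a] --> 2 * l - d x y.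
  by apply: cvgB; [exact: cvgMl_tmp|exact: cvg_cst].
by rewrite /continuous_at /busemann e.
Qed.

Lemma busemann_le x y a : `|busemann x y a| <= d x y.
Proof.
have [c ac] := rays_to_ex a; have h := busemann_cvg x y ac.
rewrite ler_norml; apply/andP; split.
  apply: (cvgr_to_ge h); near=> t; have := metric_triangle y x (c t).
  by rewrite (metric_sym y x); lra.
apply: (cvgr_to_le h); near=> t.
by have := metric_triangle x y (c t); lra.
Unshelve. all: by end_near. Qed.

(** Attained at the end of a line that extends the segment from [x] to [y]. *)
Lemma busemann_max x y : geodesic_space X -> geodesically_complete X ->
  exists a, busemann x y a = d x y.
Proof.
move=> gX cX; have [S [c [ic c0 cl _]]] := gX x y.
have l0 : 0 <= d x y by exact: mdist_ge0.
have [l ll lE] := cX _ _ l0 ic.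
have rl : geodesic_ray l by move=> s t _ _; exact: ll.
have [a al] := boundary_of_ray rl; exists a.
have h := busemann_cvg x y al.
apply: (real_cvg_eq h); apply: cvg_near_cst; near=> t.
have tl : d x y <= t by near: t; apply: nbhs_pinfty_ge; exact: num_real.
have <- : l 0 = x by rewrite lE//= in_itv/= lexx l0.
have <- : l (d x y) = y by rewrite lE//= in_itv/= lexx l0.
by rewrite !ll// !ler0_norm; lra.
Unshelve. all: by end_near. Qed.

Lemma busemann_cocycle x y z a : busemann x z a = busemann x y a + busemann y z a.
Proof.
have [c ac] := rays_to_ex a.
apply: (real_cvg_eq (busemann_cvg x z ac)).
have : (d x (c t) - d y (c t)) + (d y (c t) - d z (c t)) @[t --> +oo] -->
    busemann x y a + busemann y z a.
  by apply: cvgD; exact: busemann_cvg.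
apply: cvg_trans; apply: near_eq_cvg; near=> t; lra.
Unshelve. all: by end_near. Qed.

(** The derivative of a visual function with respect to another is the exponential
    of a Busemann function. *)
Lemma visual_busemann x y a b : visual y a b =
  expR (busemann x y a / 2) * expR (busemann x y b / 2) * visual x a b.
Proof.
have [c ac] := rays_to_ex a; have [c' bc'] := rays_to_ex b.
apply: (real_cvg_eq (visual_cvg bcX y ac bc')).
have hb e f : rays_to e f ->
    expR ((d x (f t) - d y (f t)) / 2) @[t --> +oo] --> expR (busemann x y e / 2).
  move=> ef; apply: continuous_cvg; first exact: continuous_expR.
  exact: (cvgMr_tmp (busemann_cvg x y ef)).
apply: cvg_trans (cvgM (cvgM (hb _ _ ac) (hb _ _ bc')) (visual_cvg bcX x ac bc')).
apply: near_eq_cvg; near=> t.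
by rewrite /= -!expRD; congr expR; rewrite /gromov_product; field.
Unshelve. all: by end_near. Qed.

Lemma visual_sym x a b : visual x a b = visual x b a.
Proof.
have [c ac] := rays_to_ex a; have [c' bc'] := rays_to_ex b.
have h := visual_cvg bcX x bc' ac.
apply: (real_cvg_eq (visual_cvg bcX x ac bc')).
by move: h; under eq_fun do rewrite gromov_productC.
Qed.

Lemma visual_ge0 x a b : 0 <= visual x a b.
Proof.
have [c ac] := rays_to_ex a; have [c' bc'] := rays_to_ex b.
apply: (cvgr_to_ge (visual_cvg bcX x ac bc')); near=> t; exact: expR_ge0.
Unshelve. all: by end_near. Qed.

Lemma visual_le1 x a b : visual x a b <= 1.
Proof.
have [c ac] := rays_to_ex a; have [c' bc'] := rays_to_ex b.
apply: (cvgr_to_le (visual_cvg bcX x ac bc')); near=> t.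
by rewrite -[leRHS]expR0 ler_expR oppr_le0 gromov_product_ge0.
Unshelve. all: by end_near. Qed.

Lemma visual_eq0 k x a b : four_point (X := X) k -> visual x a b = 0 <-> a = b.
Proof.
move=> H; have [c ac] := rays_to_ex a; have [c' bc'] := rays_to_ex b.
have rc := rays_to_ray ac; have rc' := rays_to_ray bc'.
have h := visual_cvg bcX x ac bc'; split => [v0|ab].
  rewrite v0 in h.
  apply: (rays_to_eq ac bc'); apply: (asymptotic_of_gromov (w := x) H rc rc').
  move=> u r.
  have /filter_ex [t [ut tr]] : \forall t \near +oo,
      u <= t /\ expR (- gp x (c t) (c' t)) < expR (- r).
    near=> t; split; near: t; first by apply: nbhs_pinfty_ge; exact: num_real.
    exact: cvgr_lt h _ (expR_gt0 _).
  by exists t, t; split => //; move: tr; rewrite ltr_expR ltrN2 => /ltW.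
apply/eqP; rewrite eq_le visual_ge0 andbT; apply/ler_addgt0Pr => e e0; rewrite add0r.
rewrite -ab in bc'.
have [T hT] := gromov_product_rays x (- ln e) rc rc' (rays_to_asymptotic ac bc').
apply: (cvgr_to_le h); near=> t.
have Tt : T <= t by near: t; apply: nbhs_pinfty_ge; exact: num_real.
by rewrite -[leRHS]lnK ?posrE// ler_expR lerNl; apply: hT.
Unshelve. all: by end_near. Qed.

(** The two ends of a line through [x] are antipodal for [x]. *)
Lemma visual_antipode k x a : proper_space X -> geodesic_space X ->
  geodesically_complete X -> four_point (X := X) k -> exists b, visual x a b = 1.
Proof.
move=> pX gX cX H; have [c0 ac0] := rays_to_ex a.
have [c [rc c0x cc0]] := ray_from_point x pX gX H (rays_to_ray ac0).
have ac := rays_to_trans ac0 rc (asymptotic_sym cc0).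
have [l ll lE] := ray_to_line pX cX rc.
have rm : geodesic_ray (fun t => l (- t)).
  by move=> s t _ _; rewrite ll// opprK -[RHS]normrN opprB addrC.
have [b bl] := boundary_of_ray rm; exists b.
apply: (real_cvg_eq (visual_cvg bcX x ac bl)).
apply: cvg_near_cst; near=> t.
have t0 : 0 <= t by near: t; apply: nbhs_pinfty_ge; exact: num_real.
suff -> : gp x (c t) (l (- t)) = 0 by rewrite oppr0 expR0.
have lx : l 0 = x by rewrite lE.
rewrite /gromov_product -lx -(lE t)// !ll//.
by rewrite !sub0r !normrN !ger0_norm; lra.
Unshelve. all: by end_near. Qed.

(** The inequality of [four_point] survives in the limit as a bound on
    cross-ratios. *)
Lemma visual_four_point k x (a b e f : boundary X) : four_point (X := X) k ->
  visual x a b * visual x e f <=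
  expR (k / 2) * (visual x a e * visual x b f + visual x a f * visual x b e).
Proof.
move=> H.
have [ca ha] := rays_to_ex a; have [cb hb] := rays_to_ex b.
have [ce he] := rays_to_ex e; have [cf hf] := rays_to_ex f.
have v u u' v v' (hu : rays_to u v) (hu' : rays_to u' v') := visual_cvg bcX x hu hu'.
apply: (ler_cvg_to (cvgM (v _ _ _ _ ha hb) (v _ _ _ _ he hf))
  (cvgMl_tmp (a := expR (k / 2)) (cvgD (cvgM (v _ _ _ _ ha he) (v _ _ _ _ hb hf))
                 (cvgM (v _ _ _ _ ha hf) (v _ _ _ _ hb he))))).
near=> t; rewrite /= mulrDr /= -!expRD.
have [h|h] := H (ca t) (cb t) (ce t) (cf t).
  rewrite ler_wpDr ?expR_ge0//.
  by rewrite ler_expR /gromov_product; lra.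
rewrite ler_wpDl ?expR_ge0//.
by rewrite ler_expR /gromov_product; lra.
Unshelve. all: by end_near. Qed.

Lemma ideal_nbhd_inner x y a r :
  r < (d x y + busemann x y a) / 2 -> ideal_nbhd x a r (Inner y).
Proof.
move=> h; have [c ac] := rays_to_ex a.
exists c, (fun=> y); split => //.
have h' : 2 * r - d x y < busemann x y a by lra.
have [T [_ hT]] := cvgr_gt _ (busemann_cvg x y ac) _ h'.
exists (T + 1) => s t sT _; rewrite gromov_productC /gromov_product.
have /hT : T < s by lra.
rewrite /=; lra.
Qed.

(** Represent boundary points by rays from [x]; along such rays the Gromov product at
    [x] is nondecreasing, so closeness at one time controls the ends. *)
Lemma boundary_compact k (x : X) : proper_space X -> geodesic_space X ->
  four_point (X := X) k -> compact [set: boundary X].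
Proof.
move=> pX gX H; rewrite compact_ultra => F FU _.
have ray b : {c : R -> X | [/\ geodesic_ray c, c 0 = x & rays_to b c]}.
  apply: cid; have [c0 bc0] := rays_to_ex b.
  have [c [rc c0x cc0]] := ray_from_point x pX gX H (rays_to_ray bc0).
  exists c; split => //; exact: rays_to_trans bc0 rc (asymptotic_sym cc0).
pose c b := sval (ray b).
have I0 t : 0 <= t -> `[0, +oo[%classic t by move=> t0; rewrite /= in_itv/= t0.
have [|||e re lim] := @isometric_ultralimit _ _ _ F `[0, +oo[%classic c 0 x 0 pX FU.
- exact: I0.
- by near=> b; have [_ + _] := svalP (ray b); rewrite /c => ->; rewrite mdistxx.
- by move=> s t s0 t0; near=> b; have [+ _ _] := svalP (ray b); apply.
have e0 : e 0 = x.
  apply: (mdist_cvg_eq (lim _ (I0 _ (lexx 0)))); apply: cvg_near_cst.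
  by near=> b; have [] := svalP (ray b).
have [a ae] := boundary_of_ray re; exists a; split => //.
move=> B /=; rewrite nbhsE => -[_ [[W [oWi oW] <-] Wa] WB].
have [r hr] := oW a Wa x.
pose T := Num.max 0 (r + 1).
have T0 : 0 <= T by rewrite le_max lexx.
have Tr : r + 1 <= T by rewrite le_max lexx orbT.
have near1 : \forall b \near F, d (e T) (c b T) < 1.
  by have /metricType_numDomainType.cvgr_dist_lt := lim T (I0 _ T0); apply.
suff : \forall b \near F, B b by [].
near=> b; apply/WB/hr; have [rb cb0 bb] := svalP (ray b).
exists e, (c b); split => //; exists T => s t Ts Tt.
have eb : d (e T) (c b T) < 1 by near: b.
have h1 := ray_dist re T0 Ts; have h2 := ray_dist rb T0 Tt.
have h3 := ray_dist re (lexx 0) (le_trans T0 Ts); have h4 := ray_dist rb (lexx 0) (le_trans T0 Tt).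
rewrite e0 in h3; rewrite cb0 in h4; rewrite /gromov_product /c.
have h5 := metric_triangle (e s) (e T) (sval (ray b) t).
have h6 := metric_triangle (e T) (sval (ray b) T) (sval (ray b) t).
have h7 := metric_sym (e s) (e T); rewrite /c in eb; lra.
Unshelve. all: by end_near. Qed.

End Visual.

Arguments busemann_cvg {R X} bcX x y {a c}.

(** * Derivatives of Moebius equivalent functions *)

Lemma third_point (T : eqType) : (exists a b c d : T, uniq [:: a; b; c; d]) ->
  forall x y : T, exists2 z, z != x & z != y.
Proof.
move=> [a [b [c [d]]]]; rewrite /= !inE !negb_or => /and4P[/and3P[ab ac _] /andP[bc _] _ _] x y.
have [ax|ax] := eqVneq a x; have [ay|ay] := eqVneq a y.
- by exists b; rewrite -?ax -?ay eq_sym.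
- have [by_|by_] := eqVneq b y; last by exists b; rewrite // -ax eq_sym.
  by exists c; rewrite -?ax -?by_ eq_sym.
- have [bx|bx] := eqVneq b x; last by exists b; rewrite // -ay eq_sym.
  by exists c; rewrite -?ay -?bx eq_sym.
- by exists a.
Qed.

Section MoebiusDerivative.
Context {R : realType} {Z : topologicalType}.
Implicit Types (rho : Z -> Z -> R) (u v : Z -> R) (xi eta a b : Z).

Lemma separating_cvg rho (I : Type) (F : set_system I) {FF : Filter F}
    (f h : I -> Z) xi eta : separating rho -> f @ F --> xi -> h @ F --> eta ->
  rho (f i) (h i) @[i --> F] --> rho xi eta.
Proof.
move=> [crho _ _ _] fx hy.
have h2 : (f i, h i) @[i --> F] --> (xi, eta).
  exact: (@cvg_pair _ _ _ _ (nbhs xi) (nbhs eta) _ _ _ _ _ fx hy).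
exact: (cvg_comp _ _ h2 (crho (xi, eta))).
Qed.

Lemma separating_gt0 rho xi eta : separating rho -> xi != eta -> 0 < rho xi eta.
Proof.
move=> [_ ge0 _ eq0] ne; rewrite lt_neqAle ge0 andbT eq_sym.
by apply: contra ne => /eqP/eq0/eqP.
Qed.

Lemma separating_eq0 rho xi : separating rho -> rho xi xi = 0.
Proof. by move=> [_ _ _ eq0]; apply/eq0. Qed.

Lemma separating_near_neq rho xi a : separating rho -> xi != a ->
  \forall zeta \near xi, zeta != a.
Proof.
move=> srho ne; have r0 := separating_gt0 srho ne.
have h : rho zeta a @[zeta --> xi] --> rho xi a.
  exact: (separating_cvg srho cvg_id (@cvg_cst _ a _ (nbhs xi) _)).
near=> zeta; have : 0 < rho zeta a by near: zeta; exact: cvgr_gt h _ r0.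
by apply: contraTneq => ->; rewrite separating_eq0// ltxx.
Unshelve. all: by end_near. Qed.

Lemma antipodal_le1 rho xi eta : antipodal rho -> rho xi eta <= 1.
Proof.
move=> [_ s1 _]; have [hs|hs] := pselect (has_sup (range (fun p : Z * Z => rho p.1 p.2))).
  by rewrite -s1; apply: ub_le_sup; [case: hs|exists (xi, eta)].
by move: s1; rewrite sup_out// => /esym/eqP; rewrite oner_eq0.
Qed.

Hypothesis three : forall xi eta : Z, exists2 zeta, zeta != xi & zeta != eta.

(** On three points the derivative is determined by the three products of its
    values; Moebius equivalence makes the answer independent of the points. *)
Lemma log_derivative_exists rho1 rho2 : separating rho1 -> separating rho2 ->
  moebius_equiv rho1 rho2 -> exists2 u : Z -> R, continuous u &
    forall xi eta, rho2 xi eta = expR (- (u xi + u eta) / 2) * rho1 xi eta.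
Proof.
move=> s1 s2 eq12.
have p1 := separating_gt0 s1; have p2 := separating_gt0 s2.
pose q xi eta := ln (rho1 xi eta) - ln (rho2 xi eta).
have qC xi eta : q xi eta = q eta xi.
  by case: s1 s2 => [_ _ c1 _] [_ _ c2 _]; rewrite /q c1 c2.
have cross xi xi' eta eta' : uniq [:: xi; xi'; eta; eta'] ->
    q xi eta + q xi' eta' = q xi eta' + q xi' eta.
  move=> un; have := eq12 _ _ _ _ un; rewrite /cross_ratio.
  move: un; rewrite /= !inE !negb_or => /and4P[/and3P[n1 n2 n3] /andP[n4 n5] n6 _].
  move=> /(congr1 (@ln R)).
  rewrite !lnM ?lnV ?posrE ?invr_gt0 ?mulr_gt0 ?p1 ?p2// !lnM ?posrE ?p1 ?p2//.
  by rewrite /q; lra.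
pose v a b xi := q xi a + q xi b - q a b.
have vC a b xi : v a b xi = v b a xi by rewrite /v (qC a b); lra.
have v1 a b b' xi : uniq [:: xi; a; b] -> uniq [:: xi; a; b'] -> v a b xi = v a b' xi.
  have [->//|bb'] := eqVneq b b'.
  rewrite /= !inE !negb_or !andbT => /andP[/andP[n1 n2] n3] /andP[/andP[_ n4] n5].
  have := @cross xi a b b'; rewrite /= !inE !negb_or n1 n2 n3 n4 n5 bb' => /(_ isT).
  by rewrite /v; lra.
have v2 a b a' b' xi : uniq [:: xi; a; b] -> uniq [:: xi; a'; b'] -> v a b xi = v a' b' xi.
  move=> /[dup] ab + /[dup] ab'.
  rewrite /= !inE !negb_or !andbT => /andP[/andP[n1 n2] n3] /andP[/andP[n4 n5] n6].
  have [ab'E|ab'N] := eqVneq a b'.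
    rewrite -ab'E (vC a' a); apply: v1 => //.
    by rewrite /= !inE !negb_or n1 n4 ab'E eq_sym n6.
  transitivity (v a b' xi).
    by apply: v1; rewrite // /= !inE !negb_or n1 n5 ab'N.
  rewrite (vC a b') (vC a' b'); apply: v1.
    by rewrite /= !inE !negb_or n1 n5 eq_sym ab'N.
  by rewrite /= !inE !negb_or n4 n5 eq_sym n6.
have pts xi : {p : Z * Z | uniq [:: xi; p.1; p.2]}.
  apply: cid; have [a ax _] := three xi xi; have [b bx ba] := three xi a.
  by exists (a, b); rewrite /= !inE !negb_or eq_sym ax eq_sym bx eq_sym ba.
pose u xi := v (sval (pts xi)).1 (sval (pts xi)).2 xi.
have uE a b xi : uniq [:: xi; a; b] -> u xi = v a b xi.
  by move=> ab; apply: v2 => //; exact: svalP (pts xi).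
exists u.
  move=> xi; have un := svalP (pts xi); set a := (sval (pts xi)).1 in un.
  set b := (sval (pts xi)).2 in un.
  have cq c : xi != c -> q zeta c @[zeta --> xi] --> q xi c.
    move=> nc; apply: cvgB; apply: continuous_cvg.
    - by apply: continuous_ln; exact: p1.
    - exact: (separating_cvg s1 cvg_id (@cvg_cst _ c _ (nbhs xi) _)).
    - by apply: continuous_ln; exact: p2.
    - exact: (separating_cvg s2 cvg_id (@cvg_cst _ c _ (nbhs xi) _)).
  move: (un); rewrite /= !inE !negb_or !andbT => /andP[/andP[na nb] ab].
  have : v a b zeta @[zeta --> xi] --> v a b xi.
    by apply: cvgB; [apply: cvgD; exact: cq|exact: cvg_cst].
  rewrite /continuous_at (uE a b xi)//; apply: cvg_trans; apply: near_eq_cvg.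
  near=> zeta; rewrite (uE a b)// /= !inE !negb_or ab !andbT.
  by apply/andP; split; near: zeta; exact: separating_near_neq s1 _.
move=> xi eta; have [->|ne] := eqVneq xi eta.
  by rewrite !separating_eq0// mulr0.
have [e ex ee] := three xi eta.
rewrite (uE eta e xi); last by rewrite /= !inE !negb_or ne eq_sym ex eq_sym ee.
rewrite (uE xi e eta); last by rewrite /= !inE !negb_or eq_sym ne eq_sym ee eq_sym ex.
have -> : - (v eta e xi + v xi e eta) / 2 = ln (rho2 xi eta) - ln (rho1 xi eta).
  have qE : q xi eta = ln (rho1 xi eta) - ln (rho2 xi eta) by [].
  by rewrite /v (qC eta xi); lra.
by rewrite expRD expRN !lnK ?posrE ?p1 ?p2// divfK// gt_eqF// p1.
Unshelve. all: by end_near. Qed.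

Lemma moebius_deriv_eq rho1 rho2 u : separating rho1 -> continuous u ->
  (forall xi eta, rho2 xi eta = expR (- (u xi + u eta) / 2) * rho1 xi eta) ->
  moebius_deriv rho2 rho1 = fun xi => expR (- u xi).
Proof.
move=> s1 cu rhoE.
have sqE xi eta : rho2 xi eta ^+ 2 = expR (- u xi) * expR (- u eta) * rho1 xi eta ^+ 2.
  by rewrite rhoE exprMn -expRM_natl -expRD; congr (expR _ * _); field.
rewrite /moebius_deriv; case: xgetP => [f fE [_ f0 fS]|h]; last first.
  exfalso; apply: (h (fun xi => expR (- u xi))); split => // xi.
    by apply: continuous_cvg; [exact: continuous_expR|apply: cvgN; exact: cu].
  exact: expR_gt0.
apply/funext => xi; have [a ax _] := three xi xi; have [b bx ba] := three xi a.
pose g xi := expR (- u xi); have g0 z : 0 < g z by exact: expR_gt0.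
have eq x y : x != y -> f x * f y = g x * g y.
  move=> xy; have := fS x y; rewrite sqE; move/mulIf => -> //.
  by rewrite expf_neq0// gt_eqF// separating_gt0.
have h1 : f xi * f a = g xi * g a by apply: eq; rewrite eq_sym.
have h2 : f xi * f b = g xi * g b by apply: eq; rewrite eq_sym.
have h3 : f a * f b = g a * g b by apply: eq; rewrite eq_sym.
have : f xi ^+ 2 * (f a * f b) = g xi ^+ 2 * (f a * f b).
  have -> : f xi ^+ 2 * (f a * f b) = (f xi * f a) * (f xi * f b) by ring.
  by rewrite h1 h2 h3; ring.
have fn : f a * f b != 0 by rewrite gt_eqF// mulr_gt0.
by move=> /(mulIf fn)/eqP; rewrite eqrXn2 ?(ltW (f0 _)) ?(ltW (g0 _))// => /eqP.
Qed.

Lemma moebius_dist_eq rho1 rho2 u : separating rho1 -> continuous u ->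
  (forall xi eta, rho2 xi eta = expR (- (u xi + u eta) / 2) * rho1 xi eta) ->
  moebius_dist rho1 rho2 = sup (range (fun xi => `|u xi|)).
Proof.
move=> s1 cu rhoE; rewrite /moebius_dist (moebius_deriv_eq s1 cu rhoE).
by congr sup; congr image; apply/funext => xi; rewrite expRK normrN.
Qed.

Lemma moebius_equiv_rescale rho1 rho2 u : separating rho1 ->
  (forall xi eta, rho2 xi eta = expR (- (u xi + u eta) / 2) * rho1 xi eta) ->
  moebius_equiv rho1 rho2.
Proof.
move=> s1 rhoE xi xi' eta eta'.
rewrite /= !inE !negb_or => /and4P[/and3P[n1 n2 n3] /andP[n4 n5] n6 _].
have p x y : x != y -> rho1 x y != 0 by move=> xy; rewrite gt_eqF// separating_gt0.
have e x : expR x != 0 by rewrite gt_eqF// expR_gt0.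
have es x y : expR (- (u x + u y) / 2) = expR (- u x / 2) * expR (- u y / 2).
  by rewrite -expRD; congr expR; field.
rewrite /cross_ratio !rhoE !es; field.
by rewrite !e !p.
Qed.

End MoebiusDerivative.

(** * The Moebius space as a tight span *)

Section Tight.
Context {R : realType} {Z : topologicalType}.
Variable rho : Z -> Z -> R.
Implicit Types (u v h : Z -> R) (xi eta a b : Z).

Definition logsq xi eta : R := 2 * ln (rho xi eta).

Definition admissible u := forall xi eta, xi != eta -> logsq xi eta <= u xi + u eta.

Definition extremal u := forall xi e, 0 < e ->
  exists2 eta, eta != xi & u xi + u eta < logsq xi eta + e.

Definition bounded_by (C : R) u := forall xi, `|u xi| <= C.

Definition tight u := [/\ exists C, bounded_by C u, admissible u & extremal u].

(** The points of the Moebius space of [rho], each antipodal function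
    [expR (- (u xi + u eta) / 2) * rho xi eta] being represented by [u]: these are
    the extremal functions of the tight span of the distance [logsq], which takes
    the value minus infinity on the diagonal. *)
Record tight_span := TightSpan { tight_fun :> Z -> R; tightP : tight tight_fun }.

HB.instance Definition _ := gen_eqMixin tight_span.
HB.instance Definition _ := gen_choiceMixin tight_span.

Lemma tight_fun_inj (f g : tight_span) : (forall xi, f xi = g xi) -> f = g.
Proof.
case: f g => [u tu] [v tv] /= uv; have : u = v by apply/funext.
by move=> uE; move: tu; rewrite uE => tu; rewrite (Prop_irrelevance tu tv).
Qed.

Definition tight_dist (f g : tight_span) : R :=
  sup (range (fun xi => `|f xi - g xi|)).

Lemma tight_has_sup (f g : tight_span) :
  has_ubound (range (fun xi => `|f xi - g xi|)).
Proof.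
have [[C fC] _ _] := tightP f; have [[D gD] _ _] := tightP g.
exists (C + D) => _ [xi _ <-]; rewrite (le_trans (ler_normB _ _))// lerD//.
Qed.

Lemma tight_dist_ge (f g : tight_span) xi : `|f xi - g xi| <= tight_dist f g.
Proof. by apply: ub_le_sup; [exact: tight_has_sup|exists xi]. Qed.

Lemma tight_dist_le (f g : tight_span) r : 0 <= r ->
  (forall xi, `|f xi - g xi| <= r) -> tight_dist f g <= r.
Proof.
move=> r0 h; have [[_ [xi _ _]]|n0] := pselect (range (fun xi => `|f xi - g xi|) !=set0).
  by apply: ge_sup; [exists `|f xi - g xi|; exists xi|move=> _ [x _ <-]].
by rewrite /tight_dist sup_out// => -[].
Qed.

Lemma tight_dist_ge0 (f g : tight_span) : 0 <= tight_dist f g.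
Proof.
have [[xi _]|n0] := pselect ([set: Z] !=set0).
  exact: le_trans (tight_dist_ge f g xi).
rewrite /tight_dist sup_out// => -[[_ [xi _ _]] _].
by apply: n0; exists xi.
Qed.

Lemma tight_distxx f : tight_dist f f = 0.
Proof.
apply/eqP; rewrite eq_le tight_dist_ge0 andbT.
by apply: tight_dist_le => // xi; rewrite subrr normr0.
Qed.

Lemma tight_dist_positivity f g : tight_dist f g = 0 -> f = g.
Proof.
move=> fg0; apply: tight_fun_inj => xi; apply/eqP.
by have := tight_dist_ge f g xi; rewrite fg0 normr_le0 subr_eq0.
Qed.

Lemma tight_dist_sym f g : tight_dist f g = tight_dist g f.
Proof. by congr sup; congr image; apply/funext => xi; rewrite distrC. Qed.

Lemma tight_dist_triangle (g f k : tight_span) : tight_dist f k <= tight_dist f g + tight_dist g k.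
Proof.
apply: tight_dist_le => [|xi]; first by rewrite addr_ge0 ?tight_dist_ge0.
rewrite (le_trans (ler_distD (g xi) _ _))// lerD// tight_dist_ge//.
Qed.

HB.instance Definition _ := isMetric.Build R tight_span tight_distxx
  tight_dist_positivity tight_dist_sym tight_dist_triangle.

(** * The nonexpansive retraction onto the tight span *)

Hypothesis rhoC : forall xi eta, rho xi eta = rho eta xi.
Hypothesis two : forall xi : Z, exists eta, eta != xi.

Lemma logsqC xi eta : logsq xi eta = logsq eta xi.
Proof. by rewrite /logsq rhoC. Qed.

(** The least value at [xi] compatible with the values of [h] elsewhere; extremal
    functions are the admissible [h] with [star h = h]. *)
Definition star h xi : R := sup [set logsq xi eta - h eta | eta in [set eta | eta != xi]].

Lemma star_ub h xi r : admissible h -> r = h xi ->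
  ubound [set logsq xi eta - h eta | eta in [set eta | eta != xi]] r.
Proof.
move=> ah -> _ [eta /= ne <-]; have := ah xi eta; rewrite eq_sym ne => /(_ isT); lra.
Qed.

Lemma star_ge h xi eta : admissible h -> eta != xi -> logsq xi eta - h eta <= star h xi.
Proof.
by move=> ah ne; apply: ub_le_sup; [exists (h xi); exact: star_ub|exists eta].
Qed.

Lemma star_le h xi r : (forall eta, eta != xi -> logsq xi eta - h eta <= r) ->
  star h xi <= r.
Proof.
move=> hr; apply: ge_sup => [|_ [eta ne <-]]; last exact: hr.
by have [eta ne] := two xi; exists (logsq xi eta - h eta); exists eta.
Qed.

Lemma star_le_self h xi : admissible h -> star h xi <= h xi.
Proof.
move=> ah; apply: star_le => eta ne.
by have := ah xi eta; rewrite eq_sym ne => /(_ isT); lra.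
Qed.

Lemma star_adherent h xi e : admissible h -> 0 < e ->
  exists2 eta, eta != xi & star h xi - e < logsq xi eta - h eta.
Proof.
move=> ah e0; have [|_ [eta ne <-] he] := @sup_adherent _ _ _ e0
  (_ : has_sup [set logsq xi eta - h eta | eta in [set eta | eta != xi]]).
  split; last by exists (h xi); exact: star_ub.
  by have [eta ne] := two xi; exists (logsq xi eta - h eta); exists eta.
by exists eta.
Qed.

(** Replacing [h] by [star h] loses admissibility, their mean does not: this is the
    step of Dress's retraction onto the tight span. *)
Definition star_mean h xi : R := (h xi + star h xi) / 2.

Lemma star_mean_admissible h : admissible h -> admissible (star_mean h).
Proof.
move=> ah xi eta ne; have := @star_ge h xi eta ah; have := @star_ge h eta xi ah.
by rewrite ne eq_sym ne (logsqC eta) /star_mean => /(_ isT) ? /(_ isT) ?; lra.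
Qed.

Lemma star_mean_le h xi : admissible h -> star_mean h xi <= h xi.
Proof. by move=> ah; have := star_le_self xi ah; rewrite /star_mean; lra. Qed.

Lemma star_lip h h' r : admissible h -> admissible h' ->
  (forall xi, `|h xi - h' xi| <= r) -> forall xi, `|star h xi - star h' xi| <= r.
Proof.
move=> ah ah' hr xi; rewrite ler_norml lerBlDr lerNl opprB lerBlDl; apply/andP; split.
  apply: star_le => eta ne; have := star_ge ah ne; have := hr eta.
  by rewrite ler_norml; lra.
apply: star_le => eta ne; have := star_ge ah' ne; have := hr eta.
by rewrite ler_norml; lra.
Qed.

Lemma star_mean_lip h h' r : admissible h -> admissible h' ->
  (forall xi, `|h xi - h' xi| <= r) -> forall xi, `|star_mean h xi - star_mean h' xi| <= r.
Proof.
move=> ah ah' hr xi; have := star_lip ah ah' hr xi; have := hr xi.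
by rewrite /star_mean !ler_norml; lra.
Qed.

Lemma iter_star_mean_admissible h n : admissible h -> admissible (iter n star_mean h).
Proof. by move=> ah; elim: n => //= n; exact: star_mean_admissible. Qed.

Lemma iter_star_mean_le h n xi : admissible h -> iter n star_mean h xi <= h xi.
Proof.
move=> ah; elim: n => //= n; apply: le_trans.
exact/star_mean_le/iter_star_mean_admissible.
Qed.

Lemma iter_star_mean_lip h h' r n : admissible h -> admissible h' ->
  (forall xi, `|h xi - h' xi| <= r) ->
  forall xi, `|iter n star_mean h xi - iter n star_mean h' xi| <= r.
Proof.
move=> ah ah' hr; elim: n => //= n ih.
by apply: star_mean_lip => //; exact: iter_star_mean_admissible.
Qed.

(** The iterates are nonincreasing, so this infimum is their limit. *)
Definition retract h xi : R := inf (range (fun n => iter n star_mean h xi)).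

Lemma retract_cvg h xi : admissible h ->
  iter n star_mean h xi @[n --> \oo] --> retract h xi.
Proof.
move=> ah; apply: nonincreasing_cvgn.
  apply/nonincreasing_seqP => n /=.
  exact/star_mean_le/iter_star_mean_admissible.
have [eta ne] := two xi; exists (logsq xi eta - h eta) => _ [n _ <-].
have := @iter_star_mean_admissible h n ah xi eta; rewrite eq_sym ne => /(_ isT).
by have := iter_star_mean_le n eta ah; lra.
Qed.

Arguments retract_cvg {h} xi.

Lemma retract_le h xi : admissible h -> retract h xi <= h xi.
Proof.
move=> ah; apply: (cvgr_to_le (retract_cvg xi ah)); near=> n.
exact: iter_star_mean_le.
Unshelve. all: by end_near. Qed.

Lemma retract_le_iter h n xi : admissible h -> retract h xi <= iter n star_mean h xi.
Proof.
move=> ah; apply: (cvgr_to_le (retract_cvg xi ah)); near=> m.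
have nm : (n <= m)%N by near: m; exact: nbhs_infty_ge.
rewrite -(subnKC nm) addnC iterD; apply: iter_star_mean_le.
exact: iter_star_mean_admissible.
Unshelve. all: by end_near. Qed.

Lemma retract_lip h h' r : admissible h -> admissible h' ->
  (forall xi, `|h xi - h' xi| <= r) -> forall xi, `|retract h xi - retract h' xi| <= r.
Proof.
move=> ah ah' hr xi.
apply: (cvgr_to_le (cvg_norm (cvgB (retract_cvg xi ah) (retract_cvg xi ah')))).
by near=> n; exact: iter_star_mean_lip.
Unshelve. all: by end_near. Qed.

Lemma retract_admissible h : admissible h -> admissible (retract h).
Proof.
move=> ah xi eta ne.
apply: (cvgr_to_ge (cvgD (retract_cvg xi ah) (retract_cvg eta ah))).
by near=> n; apply: iter_star_mean_admissible.
Unshelve. all: by end_near. Qed.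

(** Once a step of the iteration moves the value at [xi] by less than [e / 2], the
    current function is within [e] of its star there. *)
Lemma retract_extremal h : admissible h -> extremal (retract h).
Proof.
move=> ah xi e e0; have e4 : 0 < e / 4 by lra.
have [n hn] : exists n, iter n star_mean h xi < retract h xi + e / 4.
  have : \forall n \near \oo, iter n star_mean h xi < retract h xi + e / 4.
    by apply: cvgr_lt (retract_cvg xi ah) _ _; lra.
  by move=> /filter_ex[n ?]; exists n.
have an := iter_star_mean_admissible n ah.
have [eta ne he] := star_adherent xi an e4; exists eta => //.
have := retract_le_iter n.+1 xi ah; have := retract_le_iter n eta ah.
by rewrite /= /star_mean; lra.
Qed.

Lemma retract_id u : admissible u -> extremal u -> retract u = u.
Proof.
move=> au eu.
have su : star_mean u = u.
  apply/funext => xi; apply/eqP; rewrite eq_le star_mean_le//=.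
  suff : u xi <= star u xi by rewrite /star_mean; lra.
  apply/ler_addgt0Pr => e e0; have [eta ne he] := eu xi e e0.
  by have := star_ge au ne; lra.
apply/funext => xi; apply: (real_cvg_eq (retract_cvg xi au)).
have iu n : iter n star_mean u = u by elim: n => //= n ->.
by under eq_fun do rewrite iu; exact: cvg_cst.
Qed.

Lemma retract_tight h (u : tight_span) r : admissible h ->
  (forall xi, `|h xi - u xi| <= r) -> tight (retract h).
Proof.
move=> ah hr; have [[C uC] au eu] := tightP u; split.
- exists (r + C) => xi; have := retract_lip ah au hr xi; rewrite (retract_id au eu).
  by have := uC xi; rewrite !ler_norml; lra.
- exact: retract_admissible.
- exact: retract_extremal.
Qed.

End Tight.

(** * Geometry of the tight span *)

Section Span.
Context {R : realType} {Z : topologicalType}.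
Variable rho : Z -> Z -> R.
Implicit Types (u v h : Z -> R) (xi eta zeta : Z) (f g : tight_span rho).
Hypothesis arho : antipodal rho.
Hypothesis cZ : compact [set: Z].
Hypothesis three : forall xi eta : Z, exists2 zeta, zeta != xi & zeta != eta.

Local Notation P := (logsq rho).
Local Notation M := (tight_span rho).

Let srho : separating rho. Proof. by have [] := arho. Qed.
Let rhoC xi eta : rho xi eta = rho eta xi. Proof. by case: srho. Qed.
Let two xi : exists eta, eta != xi. Proof. by have [eta] := three xi xi; exists eta. Qed.

Lemma logsq_expR xi eta r : xi != eta -> (expR r <= rho xi eta) = (2 * r <= P xi eta).
Proof.
move=> ne; rewrite -[X in _ <= X]lnK ?posrE ?separating_gt0// ler_expR /logsq.
by apply/idP/idP => h; lra.
Qed.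

Lemma logsq_expR_le xi eta r : xi != eta -> (rho xi eta <= expR r) = (P xi eta <= 2 * r).
Proof.
move=> ne; rewrite -[X in X <= _]lnK ?posrE ?separating_gt0// ler_expR /logsq.
by apply/idP/idP => h; lra.
Qed.

Lemma logsq_le0 xi eta : xi != eta -> P xi eta <= 0.
Proof.
move=> ne; have := logsq_expR_le 0 ne; rewrite expR0 antipodal_le1// mulr0.
by move=> /esym.
Qed.

Lemma antipode_neq xi eta r : 0 < r -> r <= rho xi eta -> xi != eta.
Proof.
by move=> r0; apply: contraTneq => ->; rewrite separating_eq0// -ltNge.
Qed.

Lemma admissible_rho u xi eta : admissible rho u -> rho xi eta <= expR ((u xi + u eta) / 2).
Proof.
move=> au; have [->|ne] := eqVneq xi eta; first by rewrite separating_eq0// expR_ge0.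
by rewrite logsq_expR_le//; have := au _ _ ne; lra.
Qed.

Lemma tight_zero : tight rho (fun=> 0).
Proof.
split; first by exists 0 => xi; rewrite normr0.
- by move=> xi eta ne; rewrite addr0 logsq_le0.
- move=> xi e e0; have [_ _ anti] := arho; have [eta r1] := anti xi.
  have ne : xi != eta by apply: (@antipode_neq _ _ 1) => //; rewrite r1.
  exists eta; first by rewrite eq_sym.
  have := logsq_expR 0 ne; rewrite expR0 r1 lexx mulr0 => /esym h.
  by rewrite addr0; lra.
Qed.

Lemma rho_uniform xi0 (e : R) : 0 < e ->
  \forall xi \near xi0, forall eta, `|rho xi eta - rho xi0 eta| <= e.
Proof.
move=> e0; have e2 : 0 < e / 2 by lra.
suff : \forall xi \near xi0, [set: Z] `<=` (fun eta => `|rho xi eta - rho xi0 eta| <= e).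
  by apply: filterS => xi hxi eta; exact: hxi.
have /compact_near_coveringP := cZ; apply => eta _.
have c1 : rho p.2 p.1 @[p --> (eta, xi0)] --> rho xi0 eta.
  exact: (separating_cvg srho (@cvg_snd _ _ (nbhs eta) (nbhs xi0) _)
    (@cvg_fst _ _ (nbhs eta) (nbhs xi0) _)).
have c2 : rho xi0 p.1 @[p --> (eta, xi0)] --> rho xi0 eta.
  exact: (separating_cvg srho (cvg_cst xi0) (@cvg_fst _ _ (nbhs eta) (nbhs xi0) _)).
near=> p; rewrite (le_trans (ler_distD (rho xi0 eta) _ _))// [leRHS]splitr lerD//.
  by rewrite distrC; near: p; move/cvgrPdist_le: c1; apply.
by near: p; move/cvgrPdist_le: c2; apply.
Unshelve. all: by end_near. Qed.

(** At a near antipode of [x] the value of [rho] is at least [expR (- C - 1)], so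
    that the hypothesis is a bound on the relative variation of [rho] there, worth
    [e / 2] in [logsq]; the other [e / 2] pays for the antipode being only near. *)
Lemma tight_modulus u C e x y : 0 < e -> tight rho u -> bounded_by C u ->
  (forall eta, `|rho x eta - rho y eta| <= expR (- C - 1) * (1 - expR (- e / 4))) ->
  u x - u y <= e.
Proof.
move=> e0 [_ au eu] uC close.
pose e' := Num.min (e / 2) 1.
have e'0 : 0 < e' by rewrite lt_min; lra.
have e'1 : e' <= 1 by rewrite ge_min lexx orbT.
have e'2 : e' <= e / 2 by rewrite ge_min lexx.
have [eta ne he] := eu x e' e'0; rewrite eq_sym in ne.
have m : expR (- C - 1) <= rho x eta.
  rewrite logsq_expR//; have := uC x; have := uC eta; rewrite !ler_norml; lra.
have q : rho x eta * expR (- e / 4) <= rho y eta.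
  have := close eta; rewrite ler_norml => /andP[_].
  have : expR (- C - 1) * (1 - expR (- e / 4)) <= rho x eta * (1 - expR (- e / 4)).
    by rewrite ler_wpM2r// subr_ge0 -[leRHS]expR0 ler_expR; lra.
  by lra.
have x0 : 0 < rho x eta by exact: separating_gt0.
have y0 : 0 < rho x eta * expR (- e / 4) by rewrite mulr_gt0// expR_gt0.
have ney : y != eta by exact: antipode_neq y0 q.
move: q; rewrite -[rho x eta]lnK ?posrE// -expRD logsq_expR// => q.
by have := au _ _ ney; move: q he; rewrite /logsq; lra.
Qed.

(** The near antipodes of a point stay at a definite [rho]-distance from it, so the
    modulus of continuity comes from [rho] and the bound [C] alone. *)
Lemma tight_equicontinuous C xi0 e : 0 < e ->
  \forall xi \near xi0, forall u, tight rho u -> bounded_by C u -> `|u xi - u xi0| <= e.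
Proof.
move=> e0; pose m := expR (- C - 1) * (1 - expR (- e / 4)).
have m0 : 0 < m.
  by rewrite mulr_gt0 ?expR_gt0// subr_gt0 -[ltRHS]expR0 ltr_expR; lra.
near=> xi => u tu uC.
have h : forall eta, `|rho xi eta - rho xi0 eta| <= m by near: xi; exact: rho_uniform.
rewrite ler_norml; apply/andP; split; last exact: (@tight_modulus u C).
rewrite lerNl opprB; apply: (@tight_modulus u C) => // eta; rewrite distrC; exact: h.
Unshelve. all: by end_near. Qed.

Lemma tight_continuous u : tight rho u -> continuous u.
Proof.
move=> tu xi; have [[C uC] _ _] := tu; apply/cvgrPdist_le => e e0; near=> zeta.
rewrite distrC.
have : forall u, tight rho u -> bounded_by C u -> `|u zeta - u xi| <= e.
  by near: zeta; exact: tight_equicontinuous.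
by apply.
Unshelve. all: by end_near. Qed.

Lemma compact_max (h : Z -> R) : continuous h -> exists x, forall y, h y <= h x.
Proof.
move=> ch; have Z0 : [set: Z] !=set0.
  have [_ s1 _] := arho; apply: contrapT => n0.
  move: s1; rewrite sup_out; first by move/esym/eqP; rewrite oner_eq0.
  by move=> [[_ [[x y] _ _]] _]; apply: n0; exists x.
have [x _ hx] := compact_EVT_max Z0 cZ (continuous_subspaceT ch).
by exists x => y; apply: hx; rewrite inE.
Qed.

Lemma continuous_rho_slice xi : continuous (rho xi).
Proof.
move=> eta; exact: (separating_cvg srho (@cvg_cst _ xi _ (nbhs eta) _) cvg_id).
Qed.

Lemma tight_attained u xi : tight rho u ->
  exists2 eta, xi != eta & u xi + u eta = P xi eta.
Proof.
move=> tu; have [_ au eu] := tu.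
pose h eta := rho xi eta * expR (- u eta / 2).
have ch : continuous h.
  move=> eta; apply: cvgM; first exact: continuous_rho_slice.
  apply: continuous_cvg; first exact: continuous_expR.
  apply: cvgMr_tmp; apply: cvgN; exact: tight_continuous.
have [eta hmax] := compact_max ch.
have e0 e : 0 < e -> expR ((u xi - e) / 2) <= h eta.
  move=> e0; have [zeta ne he] := eu xi e e0; apply: le_trans (hmax zeta).
  rewrite eq_sym in ne; rewrite /h -[rho xi zeta]lnK ?posrE ?separating_gt0//.
  by rewrite -expRD ler_expR; move: he; rewrite /logsq; lra.
have r0 : 0 < rho xi eta.
  have := lt_le_trans (expR_gt0 _) (e0 1 ltr01).
  by rewrite /h pmulr_lgt0// expR_gt0.
have ne := antipode_neq r0 (lexx _).
exists eta => //; apply/eqP; rewrite eq_le au// andbT.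
apply/ler_addgt0Pr => e /e0; rewrite /h -[rho xi eta]lnK ?posrE//.
by rewrite -expRD ler_expR /logsq; lra.
Qed.

Lemma tight_mdist_norm f g xi : `|f xi - g xi| <= mdist f g.
Proof. exact: tight_dist_ge. Qed.

(** The distance is attained at both ends of an antipodal pair, once with each
    sign; this is what makes the sup metric a tight span metric. *)
Lemma tight_dist_attained f g : exists zeta zeta', [/\ zeta != zeta',
  f zeta - g zeta = mdist f g, g zeta' - f zeta' = mdist f g,
  f zeta + f zeta' = P zeta zeta' & g zeta + g zeta' = P zeta zeta'].
Proof.
have [x0 hx0] : exists x, forall y, `|f y - g y| <= `|f x - g x|.
  apply: compact_max => x; apply: cvg_norm; apply: cvgB.
    exact: tight_continuous (tightP f) x.
  exact: tight_continuous (tightP g) x.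
have dE : mdist f g = `|f x0 - g x0|.
  apply/eqP; rewrite eq_le (tight_mdist_norm f g x0) andbT.
  by apply: tight_dist_le => // x; rewrite hx0.
have [x hx] : exists x, f x - g x = mdist f g.
  have [h|h] := leP 0 (f x0 - g x0); first by exists x0; rewrite dE ger0_norm.
  have [y ne hy] := tight_attained x0 (tightP g).
  exists y; apply/eqP; rewrite eq_le (le_trans (ler_norm _) (tight_mdist_norm f g y))/=.
  have [_ af _] := tightP f; have := af _ _ ne; rewrite dE ltr0_norm//; lra.
have [y ne hy] := tight_attained x (tightP f).
exists x, y; have [_ ag _] := tightP g; have := ag _ _ ne.
have := tight_mdist_norm f g y; rewrite ler_norml => /andP[h1 h2] h3.
by split => //; lra.
Qed.

Lemma tight_mdist_ge f g xi : f xi - g xi <= mdist f g.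
Proof. exact: le_trans (ler_norm _) (tight_mdist_norm f g xi). Qed.

(** Write each of the two distances through an antipodal pair of points of [Z]; the
    bound on cross-ratios then regroups the four points in two other pairs, each of
    which bounds a distance from below. *)
Lemma tight_span_four_point K : 0 < K ->
  (forall a b c d, rho a b * rho c d <= K * (rho a c * rho b d + rho a d * rho b c)) ->
  four_point (X := M) (2 * ln (2 * K)).
Proof.
move=> K0 hK u v z w.
have [p [p' [np e1 _ e2 _]]] := tight_dist_attained u v.
have [q [q' [nq e3 _ e4 _]]] := tight_dist_attained z w.
have [[_ au _] [_ av _]] := (tightP u, tightP v).
have ln_le x y x' y' : x != y -> x' != y' ->
    rho p p' * rho q q' <= 2 * K * (rho x y * rho x' y') ->
    P p p' + P q q' <= P x y + P x' y' + 2 * ln (2 * K).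
  move=> nx nx'; have K2 : 0 < 2 * K by lra.
  have g a b : a != b -> 0 < rho a b by exact: separating_gt0.
  rewrite -ler_ln ?posrE ?mulr_gt0 ?g// !lnM ?posrE ?mulr_gt0 ?g//.
  by rewrite /logsq; lra.
have pos x y x' y' : 0 < 2 * K * (rho x y * rho x' y') -> x != y /\ x' != y'.
  have [->|?] := eqVneq x y; first by rewrite separating_eq0// mul0r mulr0 ltxx.
  have [->|?] := eqVneq x' y'; first by rewrite separating_eq0// !mulr0 ltxx.
  by [].
have pp : 0 < rho p p' * rho q q' by rewrite mulr_gt0 ?separating_gt0.
have [h|h] : rho p p' * rho q q' <= 2 * K * (rho p q * rho p' q') \/
    rho p p' * rho q q' <= 2 * K * (rho p q' * rho p' q).
  have := hK p p' q q'.
  have [le|/ltW le] := leP (rho p q' * rho p' q) (rho p q * rho p' q').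
    move=> hh; left; apply: le_trans hh _; rewrite -subr_ge0.
    have -> : 2 * K * (rho p q * rho p' q') - K * (rho p q * rho p' q' + rho p q' * rho p' q)
      = K * (rho p q * rho p' q' - rho p q' * rho p' q) by ring.
    by rewrite mulr_ge0 ?subr_ge0// ltW.
  move=> hh; right; apply: le_trans hh _; rewrite -subr_ge0.
  have -> : 2 * K * (rho p q' * rho p' q) - K * (rho p q * rho p' q' + rho p q' * rho p' q)
    = K * (rho p q' * rho p' q - rho p q * rho p' q') by ring.
  by rewrite mulr_ge0 ?subr_ge0// ltW.
- left; have [n1 n2] := pos _ _ _ _ (lt_le_trans pp h).
  have := ln_le _ _ _ _ n1 n2 h; have := av _ _ n1; have := au _ _ n2.
  by have := tight_mdist_ge v w q; have := tight_mdist_ge u z q'; lra.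
- right; have [n1 n2] := pos _ _ _ _ (lt_le_trans pp h).
  have := ln_le _ _ _ _ n1 n2 h; have := av _ _ n1; have := au _ _ n2.
  by have := tight_mdist_ge v z q'; have := tight_mdist_ge u w q; lra.
Qed.

(** Retracting a Lipschitz path of admissible functions gives a Lipschitz path in
    the span; every geodesic below is obtained in this way. *)
Lemma retract_path (h : R -> Z -> R) (J : set R) t0 f : J t0 -> h t0 = f ->
  (forall t, J t -> admissible rho (h t)) ->
  (forall s t xi, J s -> J t -> `|h s xi - h t xi| <= `|s - t|) ->
  exists c : R -> M, [/\ c t0 = f, forall t xi, J t -> c t xi <= h t xi,
    forall t, J t -> tight_fun (c t) = retract rho (h t) &
    forall s t, J s -> J t -> mdist (c s) (c t) <= `|s - t|].
Proof.
move=> Jt0 ht0 ah hl.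
have [_ af ef] := tightP f.
have pt t : {k : M | J t -> tight_fun k = retract rho (h t)}.
  apply: cid; have [Jt|nJt] := pselect (J t); last by exists f.
  have tr : tight rho (retract rho (h t)).
    apply: (retract_tight rhoC two (u := f) (r := `|t - t0|) (ah t Jt)) => xi.
    by rewrite -ht0 hl.
  by exists (TightSpan tr).
pose c t := sval (pt t); have cE t : J t -> tight_fun (c t) = retract rho (h t) := svalP (pt t).
exists c; split => //.
- by apply: tight_fun_inj => xi; rewrite cE// ht0 (retract_id rhoC two).
- by move=> t xi Jt; rewrite cE//; exact: (retract_le rhoC two xi (ah t Jt)).
- move=> s t Js Jt; apply: tight_dist_le => // xi; rewrite !cE//.
  by apply: (retract_lip rhoC two (ah s Js) (ah t Jt)) => z; exact: hl.
Qed.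

(** Retract the straight segment between two functions. *)
Lemma tight_span_geodesic : geodesic_space M.
Proof.
move=> f g; set l := mdist f g; have l0 : 0 <= l by exact: mdist_ge0.
pose h t xi := f xi + (t / l) * (g xi - f xi).
have [_ af _] := tightP f; have [_ ag _] := tightP g.
have [||||c [c0 _ cE cl]] := @retract_path h `[0, l]%classic 0 f.
- by rewrite /= in_itv/= lexx.
- by apply/funext => xi; rewrite /h mul0r mul0r addr0.
- move=> t; rewrite /= in_itv/= => /andP[t0 tl] xi eta ne.
  have [s0 s1] : 0 <= t / l /\ t / l <= 1.
    split; first exact: divr_ge0.
    have [->|/eqP ln0] := eqVneq l 0; first by rewrite invr0 mulr0.
    by rewrite ler_pdivrMr ?mul1r// lt_neqAle eq_sym l0 andbT; apply/eqP.
  have := af _ _ ne; have := ag _ _ ne; rewrite /h; nra.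
- move=> s t xi _ _; rewrite /h.
  have -> : f xi + s / l * (g xi - f xi) - (f xi + t / l * (g xi - f xi)) =
    (s - t) * (l^-1 * (g xi - f xi)) by ring.
  rewrite normrM ler_piMr// normrM ger0_norm ?invr_ge0//.
  have [->|/eqP ln0] := eqVneq l 0; first by rewrite invr0 mul0r.
  rewrite mulrC ler_pdivrMr ?mul1r; last by rewrite lt_neqAle eq_sym l0 andbT; apply/eqP.
  by rewrite distrC; exact: tight_mdist_norm.
have I (t : R) : 0 <= t <= l -> `[0, l]%classic t by rewrite /= in_itv.
have h0 : 0 <= (0 : R) <= l by rewrite lexx.
have hl : 0 <= l <= l by rewrite lexx andbT.
have cl' : c l = g.
  apply: tight_fun_inj => xi; rewrite cE; last exact: I.
  suff -> : h l = g by have [_ ? ?] := tightP g; rewrite (retract_id rhoC two).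
  apply/funext => z; rewrite /h; have [l00|ln0] := eqVneq l 0.
    have fg : f = g by apply: mdist_positivity; exact: l00.
    by rewrite l00 !mul0r addr0 fg.
  by rewrite divff// mul1r addrC subrK.
exists (c @` `[0, l]%classic), c; split => //.
have key s t : 0 <= s -> s <= t -> t <= l -> mdist (c s) (c t) = t - s.
  move=> s0 st tl; have hs : 0 <= s <= l by lra.
  have ht : 0 <= t <= l by lra.
  have := cl _ _ (I _ h0) (I _ hs); have := cl _ _ (I _ hs) (I _ ht).
  have := cl _ _ (I _ ht) (I _ hl); rewrite c0 cl'.
  rewrite !ler0_norm; try lra.
  have := metric_triangle f (c s) g; have := metric_triangle (c s) (c t) g.
  rewrite -/l => t1 t2 b1 b2 b3; apply/eqP; rewrite eq_le; lra.
move=> s t; rewrite /= !in_itv/= => /andP[s0 sl] /andP[t0' tl].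
have [st|/ltW ts] := leP s t; first by rewrite key// ler0_norm; lra.
by rewrite metric_sym key// ger0_norm; lra.
Qed.

(** Push the value at [xi] down and all other values up at unit speed, then retract. *)
Lemma tight_span_ray f xi : exists c : R -> M, [/\ geodesic_ray c, c 0 = f &
  forall t, 0 <= t -> c t xi = f xi - t].
Proof.
pose h t eta := if eta == xi then f xi - t else f eta + t.
have [_ af _] := tightP f.
have I (t : R) : 0 <= t -> `[0, +oo[%classic t by rewrite /= in_itv/= andbT.
have [||||c [c0 ch _ cl]] := @retract_path h `[0, +oo[%classic 0 f.
- exact: I.
- by apply/funext => eta; rewrite /h subr0 addr0; case: eqP => // ->.
- move=> t; rewrite /= in_itv/= andbT => t0 x y ne; have := af _ _ ne.
  rewrite /h; case: eqP => [ex|_]; case: eqP => [ey|_]; rewrite ?ex ?ey; try lra.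
  by move: ne; rewrite ex ey eqxx.
- move=> s t eta _ _; rewrite /h; case: eqP => _.
    have -> : f xi - s - (f xi - t) = t - s by ring.
    by rewrite distrC.
  by have -> : f eta + s - (f eta + t) = s - t by ring.
have cxi t : 0 <= t -> c t xi = f xi - t.
  move=> t0; have := ch t xi (I _ t0); rewrite /h eqxx => le.
  have := cl _ _ (I _ (lexx 0)) (I _ t0); rewrite c0 sub0r normrN ger0_norm// => le2.
  by have := tight_mdist_ge f (c t) xi; lra.
exists c; split => // s t; rewrite /= !in_itv/= !andbT => s0 t0.
apply/eqP; rewrite eq_le; apply/andP; split; first exact: cl (I _ s0) (I _ t0).
have := tight_mdist_norm (c s) (c t) xi; rewrite !cxi//.
have -> : f xi - s - (f xi - t) = t - s by ring.
by rewrite distrC.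
Qed.

(** If the distance of the end points is attained at the antipodal pair [p], [q],
    prolong by rays towards [p] and [q]: the value at [p] decreases at unit speed
    along the whole line, which forces it to be geodesic. *)
Lemma tight_span_complete : geodesically_complete M.
Proof.
move=> c l l0 ic.
have I (t : R) : 0 <= t <= l -> `[0, l]%classic t by rewrite /= in_itv.
have dl : mdist (c 0) (c l) = l.
  rewrite ic ?sub0r ?normrN ?ger0_norm//; apply: I; rewrite ?lexx//.
  by rewrite l0.
have [p [q [ne ep eq e1 e2]]] := tight_dist_attained (c 0) (c l).
rewrite dl in ep eq.
have [c1 [r1 c10 c1p]] := tight_span_ray (c l) p.
have [c2 [r2 c20 c2q]] := tight_span_ray (c 0) q.
pose c' t := if t < 0 then c2 (- t) else if t <= l then c t else c1 (t - l).
have up s t : s <= t -> mdist (c' s) (c' t) <= t - s.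
  have dc a b : 0 <= a -> a <= b -> b <= l -> mdist (c a) (c b) = b - a.
    by move=> a0 ab bl; rewrite ic ?ler0_norm; [lra|lra|apply: I; lra..].
  move=> st; rewrite /c'; case: ltP => s0; case: ltP => t0.
  - by rewrite metric_sym (ray_dist r2); lra.
  - have e3 := ray_dist r2 (lexx 0) (_ : 0 <= - s); rewrite c20 metric_sym in e3.
    have {}e3 := e3 ltac:(lra).
    case: (leP t l) => tl.
      have := metric_triangle (c2 (- s)) (c 0) (c t).
      by rewrite e3 dc//; lra.
    have e4 := ray_dist r1 (lexx 0) (_ : 0 <= t - l); rewrite c10 in e4.
    have {}e4 := e4 ltac:(lra).
    have := metric_triangle (c2 (- s)) (c 0) (c1 (t - l)).
    have := metric_triangle (c 0) (c l) (c1 (t - l)).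
    by rewrite dl e3 e4; lra.
  - lra.
  - case: (leP s l) => sl; case: (leP t l) => tl.
    + by rewrite dc//; lra.
    + have e4 := ray_dist r1 (lexx 0) (_ : 0 <= t - l); rewrite c10 in e4.
      have {}e4 := e4 ltac:(lra).
      have := metric_triangle (c s) (c l) (c1 (t - l)).
      by rewrite e4 dc//; lra.
    + lra.
    + by rewrite (ray_dist r1); lra.
have cp t : c' t p = c 0 p - t.
  rewrite /c'; case: ltP => t0.
    have := c2q (- t) ltac:(lra); have [_ a2 _] := tightP (c2 (- t)).
    have := a2 _ _ ne; have := tight_mdist_ge (c2 (- t)) (c2 0) p.
    by rewrite ray_isometric// ?subr0 ?ger0_norm ?c20; lra.
  case: leP => tl; last by rewrite c1p; lra.
  have h0 : 0 <= (0 : R) <= l by rewrite lexx.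
  have hl : 0 <= l <= l by rewrite lexx andbT.
  have ht : 0 <= t <= l by rewrite t0.
  have := tight_mdist_ge (c 0) (c t) p; have := tight_mdist_ge (c t) (c l) p.
  by rewrite !ic; [|exact: I..]; rewrite !ler0_norm; lra.
exists c'; last by move=> t; rewrite /= in_itv/= /c' => /andP[t0 tl]; rewrite ltNge t0 tl.
have key s t : s <= t -> mdist (c' s) (c' t) = t - s.
  move=> st; apply/eqP; rewrite eq_le up//=.
  by have := tight_mdist_ge (c' s) (c' t) p; rewrite !cp; lra.
move=> s t _ _; have [st|/ltW ts] := leP s t; first by rewrite key// ler0_norm; lra.
by rewrite metric_sym key// ger0_norm; lra.
Qed.

(** A pointwise ultralimit exists by boundedness; equicontinuity and compactness of
    [Z] make it extremal and the convergence uniform. *)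
Lemma tight_span_proper : proper_space M.
Proof.
move=> x r; rewrite compact_ultra => F FU Fb.
have [[C xC] _ _] := tightP x.
pose D := C + r.
have FD : \forall f \near F, bounded_by D (tight_fun f).
  near=> f => xi; have fx : mdist x f <= r by near: f.
  have := tight_mdist_norm x f xi; have := xC xi; rewrite /D !ler_norml; lra.
have lim xi : {l : R | tight_fun f xi @[f --> F] --> l}.
  apply: cid.
  have [|l _ cl] := @compact_ultra_cvg _ _ _ F (fun f : M => f xi) (@segment_compact R (- D) D) FU.
    near=> f; rewrite /= in_itv/= -ler_norml.
    by have : bounded_by D f; [near: f|apply].
  by exists l.
pose u xi := sval (lim xi); have uc xi : tight_fun f xi @[f --> F] --> u xi := svalP (lim xi).
have uD : bounded_by D u.
  move=> xi; apply: (cvgr_to_le (cvg_norm (uc xi))); near=> f.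
  by have : bounded_by D f; [near: f|apply].
have au : admissible rho u.
  move=> xi eta ne; apply: (cvgr_to_ge (cvgD (uc xi) (uc eta))); near=> f.
  by have [_ af _] := tightP f; exact: af.
have eu : extremal rho u.
  move=> xi e e0; have e4 : 0 < e / 4 by lra.
  have anti f : {eta | xi != eta /\ f xi + f eta = P xi eta}.
    by apply: cid; have [eta ? ?] := tight_attained xi (tightP f); exists eta.
  pose an f := sval (anti f).
  have [|eta _ ceta] := @compact_ultra_cvg _ _ _ F an cZ FU; first exact: filterE.
  have crho : rho xi (an f) @[f --> F] --> rho xi eta.
    exact: (separating_cvg srho (cvg_cst xi) ceta).
  have close : \forall f \near F, `|tight_fun f (an f) - tight_fun f eta| <= e / 4.
    have : \forall f \near F, forall v, tight rho v -> bounded_by D v -> `|v (an f) - v eta| <= e / 4.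
      exact: (ceta _ (tight_equicontinuous D eta e4)).
    by apply: filterS2 FD => f fD; apply => //; exact: tightP.
  have cexp : expR ((tight_fun f xi + tight_fun f eta) / 2 - e / 8) @[f --> F] -->
      expR ((u xi + u eta) / 2 - e / 8).
    apply: continuous_cvg; first exact: continuous_expR.
    exact: (cvgB (cvgMr_tmp (cvgD (uc xi) (uc eta))) (cvg_cst (e / 8))).
  have le : expR ((u xi + u eta) / 2 - e / 8) <= rho xi eta.
    apply: (ler_cvg_to cexp crho); near=> f.
    have [ne fe] := svalP (anti f); rewrite logsq_expR// -fe.
    have : `|f (an f) - f eta| <= e / 4 by near: f.
    by rewrite ler_norml /an; lra.
  have ne := antipode_neq (expR_gt0 _) le.
  by exists eta; rewrite 1?eq_sym//; move: le; rewrite logsq_expR//; lra.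
have tu : tight rho u by split => //; exists D.
exists (TightSpan tu).
have cv : F --> (TightSpan tu : M).
  apply/metricType_numDomainType.fcvgrPdist_lt => e e0; have e3 : 0 < e / 4 by lra.
  have : \forall f \near F, [set: Z] `<=` (fun xi => `|u xi - tight_fun f xi| <= e * (3 / 4)).
    have /compact_near_coveringP := cZ; apply => xi _.
    have h1 : \forall z \near xi, forall v, tight rho v -> bounded_by D v -> `|v z - v xi| <= e / 4.
      exact: tight_equicontinuous.
    have h2 : \forall f \near F, bounded_by D (tight_fun f) /\ `|u xi - tight_fun f xi| <= e / 4.
      near=> f; split; near: f => //; by move/cvgrPdist_le: (uc xi); apply.
    exists ([set z | forall v, tight rho v -> bounded_by D v -> `|v z - v xi| <= e / 4],
            [set f : M | bounded_by D f /\ `|u xi - f xi| <= e / 4]) => // -[z f] /= [hz [fD fx]].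
    have := hz u tu uD; have := hz f (tightP f) fD; move: fx; rewrite !ler_norml; lra.
  apply: filterS => f hf; apply: (@le_lt_trans _ _ (e * (3 / 4))); last lra.
  apply: tight_dist_le => [|xi]; first lra.
  exact: hf.
split => //=.
have h : mdist x f @[f --> F] --> mdist x (TightSpan tu).
  exact: (cvg_mdist (cvg_cst x) cv).
exact: (cvgr_to_le h).
Unshelve. all: by end_near. Qed.

End Span.

(** * A criterion for boundary continuity *)

Lemma nbhs_EFin_dist (R : realType) (r : R) (B : set (\bar R)) : nbhs r%:E B ->
  exists2 e : R, 0 < e & forall s, `|s - r| <= e -> B s%:E.
Proof.
move=> nB; have /nbhs_ballP[e /= e0 eB] : nbhs r (fun s : R => B s%:E) by exact: nB.
exists (e / 2); first lra.
move=> s sr; apply: (eB s); rewrite /ball/= distrC; lra.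
Qed.

Section Criterion.
Context {R : realType} {X : metricType R}.
Implicit Types (x y z w : X) (k r s t : R) (a b : boundary X).
Local Notation d := (@mdist R X).
Local Notation cX := (compactification X).
Local Notation gp := gromov_product.

Lemma nbhs_inner y (A : set X) : nbhs y A -> nbhs (Inner y : cX) (@Inner R X @` A).
Proof.
rewrite nbhsE => -[U [oU Uy] UA].
rewrite nbhsE; exists (@Inner R X @` U); last by move=> _ [z Uz <-]; exists z => //; exact: UA.
split; last by exists y.
split; last by move=> a [z].
rewrite (_ : _ @^-1` _ = U)//; apply/seteqP; split => [z [z' Uz' [<-]]//|z Uz].
by exists z.
Qed.

Lemma inner_dense (p : cX) : exists c : R -> X, Inner (c t) @[t --> +oo] --> p.
Proof.
case: p => [y|a]; first by exists (fun=> y); exact: cvg_cst.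
by have [c ac] := rays_to_ex a; exists c; exact: ray_cvg.
Qed.

(** The target of the Gromov product is regular and the space is dense in its
    compactification, so limits need only be checked along points of the space. *)
Lemma boundary_continuous_of_limits k : four_point (X := X) k ->
  (forall x, exists (g1 : X -> boundary X -> R) (g2 : boundary X -> boundary X -> \bar R),
    [/\ forall y b, 0 <= g1 y b, forall a b, (0 <= g2 a b)%E,
      forall y b e, 0 < e -> exists r, forall z, ideal_nbhd x b r (Inner z) ->
        `|gp x y z - g1 y b| <= e &
      forall a b B, nbhs (g2 a b) B -> exists r, forall y z,
        ideal_nbhd x a r (Inner y) -> ideal_nbhd x b r (Inner z) -> B (gp x y z)%:E]) ->
  boundary_continuous X.
Proof.
move=> H lims x; have [g1 [g2 [g10 g20 lim1 lim2]]] := lims x.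
pose g (p : cX * cX) : \bar R := match p with
  | (Inner y, Inner z) => (gp x y z)%:E
  | (Inner y, Ideal b) => (g1 y b)%:E
  | (Ideal a, Inner z) => (g1 z a)%:E
  | (Ideal a, Ideal b) => g2 a b end.
pose innerP (B : set (\bar R)) : set (cX * cX) :=
  [set q | forall y z, q = (Inner y, Inner z) -> B (gp x y z)%:E].
have nN a r : nbhs (Ideal a : cX) (ideal_nbhd x a r) by exact: nbhs_ideal_nbhd H.
have nB y e : 0 < e -> nbhs (Inner y : cX) (@Inner R X @` [set y' | d y y' < e]).
  move=> e0; apply: nbhs_inner; apply/nbhs_ballP; exists e => // z.
  by rewrite ballEmdist.
have one y b B : nbhs (g1 y b)%:E B -> exists2 e, 0 < e & exists r, forall y' z,
    d y y' < e -> ideal_nbhd x b r (Inner z) -> B (gp x y' z)%:E.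
  move=> /nbhs_EFin_dist[e e0 eB]; have e2 : 0 < e / 2 by lra.
  have [r hr] := lim1 y b _ e2; exists (e / 2) => //; exists r => y' z yy' /hr h.
  apply: eB; have := gromov_product_lip x z y y'; move: h.
  by rewrite !(gromov_productC x z) !ler_norml; lra.
have claim (p : cX * cX) B : nbhs (g p) B -> nbhs p (innerP B).
  case: p => [[y|a] [z|b]] /= gB.
  - have [e e0 eB] := nbhs_EFin_dist gB; have e2 : 0 < e / 2 by lra.
    exists (@Inner R X @` [set y' | d y y' < e / 2], @Inner R X @` [set z' | d z z' < e / 2]).
      by split; exact: nB.
    move=> [q1 q2] /= [[y' yy' <-] [z' zz' <-]] _ _ [<- <-]; apply: eB.
    have := gromov_product_lip x y' z z'; have := gromov_product_lip x z y y'.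
    by rewrite !(gromov_productC x z) !ler_norml; lra.
  - have [e e0 [r er]] := one _ _ _ gB.
    exists (@Inner R X @` [set y' | d y y' < e], ideal_nbhd x b r).
      by split; [exact: nB|exact: nN].
    by move=> [q1 q2] /= [[y' yy' <-] zb] _ z [<- zE]; apply: er => //; rewrite -zE.
  - have [e e0 [r er]] := one _ _ _ gB.
    exists (ideal_nbhd x a r, @Inner R X @` [set z' | d z z' < e]).
      by split; [exact: nN|exact: nB].
    move=> [q1 q2] /= [za [z' zz' <-]] y _ [yE <-].
    by rewrite gromov_productC; apply: er => //; rewrite -yE.
  - have [r hr] := lim2 _ _ _ gB.
    exists (ideal_nbhd x a r, ideal_nbhd x b r); first by split; exact: nN.
    by move=> [q1 q2] /= [qa qb] y z [yE zE]; apply: hr; rewrite -?yE -?zE.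
have dense (p : cX * cX) (A : set (cX * cX)) : nbhs p A -> exists y z, A (Inner y, Inner z).
  case: p => p1 p2 nA; have [c1 h1] := inner_dense p1; have [c2 h2] := inner_dense p2.
  have : \forall t \near +oo, A (Inner (c1 t), Inner (c2 t)).
    exact: (@cvg_pair _ _ _ _ (nbhs p1) (nbhs p2) _ _ _ _ _ h1 h2 _ nA).
  by move=> /filter_ex[t ?]; exists (c1 t), (c2 t).
exists g; split => //; last by move=> [[y|a] [z|b]] //=; rewrite lee_fin ?gromov_product_ge0.
move=> p B /uniform_regular[A pA AB].
have [U [oU Up] UA] : exists2 U, open_nbhs p U & U `<=` innerP A.
  by have := claim _ _ pA; rewrite nbhsE.
have pU : nbhs p U by exact: open_nbhs_nbhs.
apply: (@filterS _ (nbhs p) _ U (g @^-1` B) _ pU) => q Uq; apply: AB => V qV.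
have [y [z [Uyz /= Vyz]]] : exists y z, (U `&` innerP V) (Inner y, Inner z).
  by apply: (dense q); apply: filterI; [exact: open_nbhs_nbhs|exact: claim].
exists (gp x y z)%:E; split; [exact: UA Uyz _ _ erefl|exact: Vyz].
Qed.

End Criterion.

(** * The boundary of the tight span *)

Lemma expR_small (R : realType) (A e : R) : 0 < e ->
  exists r0, forall r, r0 <= r -> expR (A - r) <= e.
Proof.
by move=> e0; exists (A - ln e) => r rr; rewrite -[leRHS]lnK ?posrE// ler_expR; lra.
Qed.

Section Ends.
Context {R : realType} {Z : topologicalType}.
Variable rho : Z -> Z -> R.
Variable K : R.
Hypothesis arho : antipodal rho.
Hypothesis cZ : compact [set: Z].
Hypothesis three : forall xi eta : Z, exists2 zeta, zeta != xi & zeta != eta.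
Hypothesis K0 : 0 < K.
Hypothesis hK : forall a b c d,
  rho a b * rho c d <= K * (rho a c * rho b d + rho a d * rho b c).

Local Notation P := (logsq rho).
Local Notation M := (tight_span rho).
Local Notation gp := gromov_product.
Implicit Types (xi eta zeta : Z) (f g w u v : M) (c : R -> M) (a b : boundary M) (r s t e C : R).

Let srho : separating rho. Proof. by have [] := arho. Qed.
Let rhoC xi eta : rho xi eta = rho eta xi. Proof. by case: srho. Qed.
Let rho0 xi eta : 0 <= rho xi eta. Proof. by case: srho. Qed.

Let H4 : four_point (X := M) (2 * ln (2 * K)) := tight_span_four_point arho cZ K0 hK.

(** Use an antipode of [zeta] as the fourth point of the cross-ratio bound. *)
Lemma quasi_metric xi eta zeta : rho xi eta <= K * (rho xi zeta + rho zeta eta).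
Proof.
have [_ _ /(_ zeta)[z' rz]] := arho; have := hK xi eta zeta z'; rewrite rz mulr1.
move/le_trans; apply; rewrite ler_wpM2l ?(ltW K0)// lerD//.
  by rewrite ler_piMr// antipodal_le1.
by rewrite (rhoC eta) ler_piMl// antipodal_le1.
Qed.

Lemma rho_nbhs xi B : nbhs xi B -> exists2 e : R, 0 < e & forall eta, rho xi eta < e -> B eta.
Proof.
move=> xB.
have : \forall e \near (0 : R)^'+, [set: Z] `<=` (fun eta => rho xi eta < e -> B eta).
  have /compact_near_coveringP := cZ; apply => eta _.
  have [->|ne] := eqVneq eta xi.
    by exists (B, setT); [split => //; exact: filterT|move=> [z e] [/= Bz _] _].
  have r0 : 0 < rho xi eta by rewrite separating_gt0// eq_sym.
  have near_eta : \forall z \near eta, rho xi eta / 2 < rho xi z.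
    have cr : rho xi z @[z --> eta] --> rho xi eta by exact: (continuous_rho_slice arho).
    by apply: (cvgr_gt _ cr); lra.
  exists ([set z | rho xi eta / 2 < rho xi z], [set e | e < rho xi eta / 2]).
    by split; [exact: near_eta|apply: nbhs_right_lt; lra].
  by move=> [z e] /= [h1 h2] h3; have := lt_trans (lt_trans h1 h3) h2; rewrite ltxx.
move=> h; near (0 : R)^'+ => e; exists e => // eta.
have : [set: Z] `<=` (fun eta => rho xi eta < e -> B eta) by near: e.
by apply.
Unshelve. all: by end_near. Qed.

Lemma tight_rho f xi eta : rho xi eta <= expR ((f xi + f eta) / 2).
Proof. by apply: admissible_rho => //; have [] := tightP f. Qed.

(** The point of [Z] that the ray [c] converges to. *)
Definition endpoint c xi := forall t, 0 <= t -> c t xi = c 0 xi - t.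

(** Along a ray the distance to the start is attained, at every time, by points of
    [Z]; a cluster point of them serves all times at once. *)
Lemma endpoint_ex c : geodesic_ray c -> exists xi, endpoint c xi.
Proof.
move=> rc; have [U UU sU] := ultra_infty.
have pt (n : nat) : {xi | c 0 xi - c n%:R xi = n%:R}.
  apply: cid; have [x [_ [_ e _ _ _]]] := tight_dist_attained arho cZ (c 0) (c n%:R).
  by exists x; rewrite e (ray_dist rc)// subr0.
have [|xi _ cxi] := @compact_ultra_cvg _ _ _ U (fun n => sval (pt n)) cZ UU.
  exact: filterE.
exists xi => t t0.
have ch : continuous (fun z => c 0 z - c t z).
  move=> z; apply: cvgB; first exact: (tight_continuous arho cZ (tightP (c 0))).
  exact: (tight_continuous arho cZ (tightP (c t))).
have : c 0 xi - c t xi = t; last lra.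
apply: (real_cvg_eq (f := fun n => c 0 (sval (pt n)) - c t (sval (pt n))) (F := U)).
  exact: (cvg_comp _ _ cxi (ch xi)).
apply: cvg_near_cst; near=> n.
have tn : t <= n%:R by near: n; exact: near_ultra_ger.
have := svalP (pt n).
have := tight_mdist_ge (c 0) (c t) (sval (pt n)).
have := tight_mdist_ge (c t) (c n%:R) (sval (pt n)).
by rewrite !(ray_dist rc)//; lra.
Unshelve. all: by end_near. Qed.

Lemma endpoint_eq c c' xi eta : asymptotic c c' -> endpoint c xi -> endpoint c' eta ->
  xi = eta.
Proof.
move=> [B cB] cxi ceta; apply/eqP; apply: contrapT => /negP ne.
have r0 := separating_gt0 srho ne.
have [r0' h] := @expR_small _ ((c 0 xi + c' 0 eta + B) / 2) (rho xi eta / 2) ltac:(lra).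
pose t := Num.max 0 r0'; have t0 : 0 <= t by rewrite le_max lexx.
have := h t; rewrite le_max lexx orbT => /(_ isT).
suff : rho xi eta <= expR ((c 0 xi + c' 0 eta + B) / 2 - t) by lra.
apply: le_trans (tight_rho (c t) xi eta) _; rewrite ler_expR cxi//.
have := ceta t t0; have := tight_mdist_ge (c t) (c' t) eta; have := cB t t0.
lra.
Qed.

(** The direction of [u] seen from [w]; not unique, but the possible choices all
    converge to the end when [u] does. *)
Definition toward w u xi := w xi - u xi = mdist w u.

Lemma toward_ex w u : exists xi, toward w u xi.
Proof.
by have [x [_ [_ e _ _ _]]] := tight_dist_attained arho cZ w u; exists x.
Qed.

Lemma rho_le_gromov w u v xi eta : toward w u xi -> toward w v eta ->
  rho xi eta <= expR ((w xi + w eta) / 2 - gp w u v).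
Proof.
rewrite /toward => hu hv; apply: le_trans (tight_rho u xi eta) _.
rewrite ler_expR /gromov_product; have := tight_mdist_ge u v eta; lra.
Qed.

(** Conversely the points where [u - v] is extremal bound the Gromov product from
    below, and they lie towards [v] and [u] when the product is bounded. *)
Lemma gromov_le_rho w u v : exists zeta zeta',
  [/\ expR ((w zeta + w zeta') / 2 - gp w u v) <= rho zeta zeta',
      u zeta' <= w zeta' + 2 * gp w u v - mdist w u &
      v zeta <= w zeta + 2 * gp w u v - mdist w v].
Proof.
have [z [z' [ne e1 e2 e3 e4]]] := tight_dist_attained arho cZ u v.
exists z, z'.
have h1 := tight_mdist_ge w u z'; have h2 := tight_mdist_ge w v z.
have h3 := tight_mdist_ge v w z'; have h4 := tight_mdist_ge u w z.
have s1 := metric_sym w v; have s2 := metric_sym w u.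
split; rewrite ?(logsq_expR arho)// /gromov_product; lra.
Qed.

Lemma bounded_tight w : exists C, bounded_by C w.
Proof. by have [] := tightP w. Qed.

(** If the Gromov products of the two rays stayed bounded, the extremal points [z]
    and [z'] of their difference would both converge to [xi] while [rho z z'] stays
    bounded below. *)
Lemma endpoint_asymptotic c c' xi : geodesic_ray c -> geodesic_ray c' ->
  endpoint c xi -> endpoint c' xi -> asymptotic c c'.
Proof.
move=> rc rc' cxi cxi'.
apply: (asymptotic_of_gromov (w := c 0) H4 rc rc') => q r.
set w := c 0; have [C wC] := bounded_tight w.
have w1 z : - C <= w z by have := wC z; rewrite ler_norml => /andP[].
have w2 z : w z <= C by have := wC z; rewrite ler_norml => /andP[].
pose D := mdist w (c' 0); have D0 : 0 <= D by exact: mdist_ge0.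
pose A := C + `|r| + D + `|c' 0 xi|.
have r0 : 0 <= `|r| by [].
have rr : r <= `|r| by exact: ler_norm.
have x0 : 0 <= `|c' 0 xi| by [].
have xx : c' 0 xi <= `|c' 0 xi| by exact: ler_norm.
have xw := w2 xi; have C0 : 0 <= C by exact: le_trans (normr_ge0 _) (wC xi).
have e0 : 0 < expR (- C - r) / (4 * K) by rewrite divr_gt0 ?expR_gt0// mulr_gt0.
have [T0 hT0] := @expR_small _ A _ e0.
pose T := Num.max (Num.max 0 q) T0.
have T1 : 0 <= T by rewrite !le_max lexx.
have T2 : q <= T by rewrite !le_max lexx orbT.
have T3 : T0 <= T by rewrite le_max lexx orbT.
exists T, T; split => //; rewrite leNgt; apply/negP => small.
have [z [z' [h1 h2 h3]]] := gromov_le_rho w (c T) (c' T).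
have b1 := ray_dist rc (lexx 0) T1; have /andP[b2 b3] := ray_dist_base w rc' T1.
rewrite -/w in b1; rewrite -/D in b2 b3.
have := hT0 _ T3; set ee := expR (- C - r) / (4 * K) => eeh.
have k1 : rho z xi <= ee.
  apply: le_trans (tight_rho (c' T) _ _) _; apply: le_trans eeh.
  rewrite ler_expR cxi'// /A; have := w2 z; lra.
have k2 : rho xi z' <= ee.
  apply: le_trans (tight_rho (c T) _ _) _; apply: le_trans eeh.
  rewrite ler_expR cxi// -/w /A; have := w2 z'; lra.
have k3 := quasi_metric z z' xi.
have k4 : expR (- C - r) <= rho z z'.
  by apply: le_trans h1; rewrite ler_expR; have := w1 z; have := w1 z'; lra.
have k5 : K * (rho z xi + rho xi z') <= K * (ee + ee) by rewrite ler_wpM2l ?(ltW K0)// lerD.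
have k6 : K * (ee + ee) = expR (- C - r) / 2.
  by rewrite /ee; field; rewrite gt_eqF.
have := expR_gt0 (- C - r); lra.
Qed.

Definition end_at a xi := forall c, rays_to a c -> endpoint c xi.

Lemma end_at_ex a : exists xi, end_at a xi.
Proof.
have [c ac] := rays_to_ex a; have rc := rays_to_ray ac.
have [xi cxi] := endpoint_ex rc; exists xi => c' ac'.
have [eta ceta] := endpoint_ex (rays_to_ray ac').
by rewrite (endpoint_eq (rays_to_asymptotic ac ac') cxi ceta).
Qed.

Lemma end_at_inj a b xi : end_at a xi -> end_at b xi -> a = b.
Proof.
move=> ax bx; have [c ac] := rays_to_ex a; have [c' bc'] := rays_to_ex b.
apply: (rays_to_eq ac bc').
exact: endpoint_asymptotic (rays_to_ray ac) (rays_to_ray bc') (ax _ ac) (bx _ bc').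
Qed.

Lemma end_at_surj (f : M) xi : exists a, end_at a xi.
Proof.
have [c [rc c0 cxi]] := tight_span_ray arho three f xi.
have cx : endpoint c xi by move=> t t0; rewrite cxi// c0.
have [a ac] := boundary_of_ray rc; exists a => c' ac'.
have [eta ceta] := endpoint_ex (rays_to_ray ac').
by rewrite (endpoint_eq (rays_to_asymptotic ac ac') cx ceta).
Qed.

(** Points towards [v] and the extremal points of [gromov_le_rho] all satisfy the
    bound on [v zeta], so this one estimate places all of them near the end. *)
Lemma near_end w b xi e C : end_at b xi -> 0 < e ->
  exists r0, forall r, r0 <= r -> forall v, ideal_nbhd w b r (Inner v) ->
    r <= mdist w v /\ forall zeta, v zeta <= C - mdist w v -> rho xi zeta < e.
Proof.
move=> bx e0; have [B wB] := bounded_tight w.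
have w2 z : w z <= B by have := wB z; rewrite ler_norml => /andP[].
(* Two uses of [quasi_metric], through [xs] and [xv], lead from [xi] to [zeta]. *)
have p1 : 0 < e / (8 * K * K) by rewrite divr_gt0// !mulr_gt0.
have p2 : 0 < e / (8 * K) by rewrite divr_gt0// mulr_gt0.
have [r1 hr1] := @expR_small _ B _ p1.
have [r2 hr2] := @expR_small _ ((C + B) / 2) _ p2.
exists (Num.max r1 r2) => r; rewrite ge_max => /andP[r1r r2r] v [c [c' [bc c'v [T hT]]]].
rewrite /= in c'v.
have rv : r <= mdist w v.
  have := hT T T (lexx _) (lexx _); rewrite c'v gromov_productC => /le_trans; apply.
  exact: gromov_product_le.
split => // zeta hz.
have rc := rays_to_ray bc; have cxi := bx _ bc.
have [r3 hr3] := @expR_small _ ((c 0 xi + B + mdist w (c 0)) / 2) _ p1.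
pose s := Num.max (Num.max 0 T) r3.
have s0 : 0 <= s by rewrite !le_max lexx.
have sT : T <= s by rewrite !le_max lexx orbT.
have sr : r3 <= s by rewrite !le_max lexx orbT.
have [xs hs] := toward_ex w (c s); have [xv hv] := toward_ex w v.
have g1 := hT s s sT sT; rewrite c'v in g1.
have q1 : rho xs xv <= e / (8 * K * K).
  apply: le_trans (rho_le_gromov hs hv) _; apply: le_trans (hr1 _ r1r).
  by rewrite ler_expR; have := w2 xs; have := w2 xv; lra.
have q2 : rho xi xs <= e / (8 * K * K).
  apply: le_trans (tight_rho (c s) _ _) _; apply: le_trans (hr3 _ sr).
  rewrite ler_expR cxi//; have := ray_dist_base w rc s0; have := w2 xs.
  by rewrite /toward in hs; lra.
have q3 : rho xv zeta <= e / (8 * K).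
  apply: le_trans (tight_rho v _ _) _; apply: le_trans (hr2 _ r2r).
  by rewrite ler_expR; have := w2 xv; rewrite /toward in hv; lra.
have k1 := quasi_metric xi xv xs; have k2 := quasi_metric xi zeta xv.
have k3 : K * (rho xi xs + rho xs xv) <= K * (e / (8 * K * K) + e / (8 * K * K)).
  by rewrite ler_wpM2l ?(ltW K0)// lerD.
have k4 : K * (e / (8 * K * K) + e / (8 * K * K)) = e / (4 * K).
  by field; rewrite gt_eqF.
have k5 : K * (rho xi xv + rho xv zeta) <= K * (e / (4 * K) + e / (8 * K)).
  by rewrite ler_wpM2l ?(ltW K0)// lerD//; lra.
have k6 : K * (e / (4 * K) + e / (8 * K)) = e * (3 / 8) by field; rewrite gt_eqF.
lra.
Qed.

(** The antipodal function represented by [w], which turns out to be the visual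
    function of the tight span at [w]. *)
Definition rebased w xi eta : R := expR (- (w xi + w eta) / 2) * rho xi eta.

Lemma rebased_continuous w xi eta e : 0 < e -> exists2 e1, 0 < e1 &
  forall xi' eta', rho xi xi' < e1 -> rho eta eta' < e1 ->
    `|rebased w xi' eta' - rebased w xi eta| <= e.
Proof.
move=> e0.
have cr : rebased w p.1 p.2 @[p --> (xi, eta)] --> rebased w xi eta.
  have cw := tight_continuous arho cZ (tightP w).
  have c3 : rho p.1 p.2 @[p --> (xi, eta)] --> rho xi eta.
    exact: (separating_cvg srho (@cvg_fst _ _ (nbhs xi) (nbhs eta) _)
      (@cvg_snd _ _ (nbhs xi) (nbhs eta) _)).
  have c4 : expR (- (w p.1 + w p.2) / 2) @[p --> (xi, eta)] --> expR (- (w xi + w eta) / 2).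
    have c1 : w p.1 @[p --> (xi, eta)] --> w xi.
      exact: (cvg_comp _ _ (@cvg_fst _ _ (nbhs xi) (nbhs eta) _) (cw xi)).
    have c2 : w p.2 @[p --> (xi, eta)] --> w eta.
      exact: (cvg_comp _ _ (@cvg_snd _ _ (nbhs xi) (nbhs eta) _) (cw eta)).
    apply: continuous_cvg; first exact: continuous_expR.
    exact: (cvgMr_tmp (cvgN (cvgD c1 c2))).
  exact: (cvgM c4 c3).
have : \forall p \near (xi, eta), `|rebased w xi eta - rebased w p.1 p.2| <= e.
  by move/cvgrPdist_le: cr; apply.
move=> [[A B] /= [/rho_nbhs[e1 e10 h1] /rho_nbhs[e2 e20 h2]] AB].
exists (Num.min e1 e2); first by rewrite lt_min e10.
move=> xi' eta'; rewrite !lt_min => /andP[/h1 Ax _] /andP[_ /h2 Bx].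
by rewrite distrC; apply: (AB (xi', eta')).
Qed.

(** One inequality is [rho_le_gromov] at points towards [u] and [v]; for the other
    one, a product that is not already large is bounded, and then [gromov_le_rho]
    applies with points close to [xi] and [eta]. *)
Lemma gromov_rebased_cvg w a b xi eta e : end_at a xi -> end_at b eta -> 0 < e ->
  exists r, forall u v, ideal_nbhd w a r (Inner u) -> ideal_nbhd w b r (Inner v) ->
    `|expR (- gp w u v) - rebased w xi eta| <= e.
Proof.
move=> ax bx e0; have [e1 e10 he1] := rebased_continuous w xi eta e0.
have [B wB] := bounded_tight w.
have w2 z : w z <= B by have := wB z; rewrite ler_norml => /andP[].
pose L : R := `|ln e|; have L0 : 0 <= L by exact: normr_ge0.
have Le : - ln e <= L by rewrite /L -normrN; exact: ler_norm.
have [r1 hr1] := near_end w (B + 2 * L) ax e10.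
have [r2 hr2] := near_end w (B + 2 * L) bx e10.
exists (Num.max r1 r2) => u v hu hv.
have [_ nu] := hr1 (Num.max r1 r2) ltac:(by rewrite le_max lexx) u hu.
have [_ nv] := hr2 (Num.max r1 r2) ltac:(by rewrite le_max lexx orbT) v hv.
have [xu tu] := toward_ex w u; have [xv tv] := toward_ex w v.
have fact (x y : Z) (g' : R) : expR ((w x + w y) / 2 - g') = expR (- g') / expR (- (w x + w y) / 2).
  by rewrite -expRN -expRD; congr expR; field.
have lower : rebased w xu xv <= expR (- gp w u v).
  have := rho_le_gromov tu tv; rewrite fact ler_pdivlMr ?expR_gt0//.
  by rewrite /rebased mulrC.
have := he1 xu xv (nu _ _) (nv _ _); rewrite ler_norml => h.
have /andP[h1 _] : - e <= rebased w xu xv - rebased w xi eta <= e.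
  by apply: h; [have := w2 xu|have := w2 xv]; rewrite /toward in tu tv; lra.
rewrite ler_norml; apply/andP; split; first lra.
have [le|gt] := leP (expR (- gp w u v)) e.
  have : 0 <= rebased w xi eta by rewrite mulr_ge0 ?expR_ge0.
  lra.
have gL : gp w u v <= L.
  by move: gt; rewrite -[ltLHS]lnK ?posrE// ltr_expR; lra.
have [z [z' [k1 k2 k3]]] := gromov_le_rho w u v.
have upper : expR (- gp w u v) <= rebased w z' z.
  move: k1; rewrite fact ler_pdivrMr ?expR_gt0// /rebased mulrC rhoC.
  by rewrite (addrC (w z)).
have := he1 z' z (nu _ _) (nv _ _); rewrite ler_norml => h'.
have /andP[_ h3] : - e <= rebased w z' z - rebased w xi eta <= e.
  by apply: h'; [have := w2 z'|have := w2 z]; lra.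
lra.
Qed.

Lemma mdist_end_cvg w u b xi e : end_at b xi -> 0 < e ->
  exists r, forall v, ideal_nbhd w b r (Inner v) ->
    `|mdist u v - mdist w v - (u xi - w xi)| <= e.
Proof.
move=> bx e0; have [B wB] := bounded_tight w; have [C uC] := bounded_tight u.
have w2 z : w z <= B by have := wB z; rewrite ler_norml => /andP[].
have u2 z : u z <= C by have := uC z; rewrite ler_norml => /andP[].
have ch : (fun z => u z - w z) @ xi --> u xi - w xi.
  apply: cvgB; first exact: (tight_continuous arho cZ (tightP u)).
  exact: (tight_continuous arho cZ (tightP w)).
have : \forall z \near xi, `|u xi - w xi - (u z - w z)| <= e.
  by move/cvgrPdist_le: ch; apply.
move=> /rho_nbhs[e1 e10 he1].
pose A := `|B| + `|C| + mdist w u.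
have [AB AC] : B <= A /\ C + mdist w u <= A.
  have := ler_norm B; have := ler_norm C; have := mdist_ge0 w u.
  by have := normr_ge0 B; have := normr_ge0 C; rewrite /A; lra.
have [r0 hr0] := near_end w A bx e10; exists r0 => v /(hr0 _ (lexx _))[_ nv].
have [xv tv] := toward_ex w v; rewrite /toward in tv.
have [z [_ [_ ez _ _ _]]] := tight_dist_attained arho cZ u v.
have s := metric_sym w u.
have b1 : rho xi xv < e1 by apply: nv; have := w2 xv; lra.
have b2 : rho xi z < e1.
  by apply: nv; have := u2 z; have := metric_triangle w u v; lra.
have := he1 _ b1; have := he1 _ b2; rewrite !ler_norml.
by have := tight_mdist_ge u v xv; have := tight_mdist_ge w v z; lra.
Qed.

Lemma tight_span_boundary_continuous : boundary_continuous M.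
Proof.
have [E hE] : {E : boundary M -> Z | forall a, end_at a (E a)}.
  by exists (fun a => sval (cid (end_at_ex a))) => a; exact: svalP (cid (end_at_ex a)).
apply: (boundary_continuous_of_limits H4) => w.
have reb0 x y : x != y -> 0 < rebased w x y.
  by move=> ne; rewrite mulr_gt0 ?expR_gt0 ?separating_gt0.
have reb1 x y : rebased w x y <= 1.
  apply: le_trans (ler_wpM2l (expR_ge0 _) (tight_rho w x y)) _.
  by rewrite -expRD -[leRHS]expR0 ler_expR; lra.
exists (fun u b => (mdist w u + w (E b) - u (E b)) / 2).
exists (fun a b => if E a == E b then +oo%E else (- ln (rebased w (E a) (E b)))%:E).
split.
- move=> u b; have := tight_mdist_ge u w (E b); rewrite metric_sym; lra.
- move=> a b; case: eqVneq => [//|ne]; rewrite lee_fin oppr_ge0.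
  by rewrite -ln1 ler_ln ?posrE ?reb0.
- move=> u b e e0; have e2 : 0 < e * 2 by lra.
  have [r hr] := mdist_end_cvg w u (hE b) e2; exists r => v /hr.
  by rewrite /gromov_product !ler_norml; lra.
- move=> a b B; case: eqVneq => [ab|ne] gB.
    have [A hA] : exists A : R, forall x : \bar R, (A%:E < x)%E -> B x.
      by have [A [_ hA]] := gB; exists A.
    have [r hr] := gromov_rebased_cvg w (hE a) (hE b) (expR_gt0 (- A - 1)).
    exists r => u v nu nv; apply: hA; rewrite lte_fin.
    have := hr u v nu nv; rewrite ab /rebased (separating_eq0 _ srho) mulr0 subr0.
    by rewrite ger0_norm ?expR_ge0// ler_expR; lra.
  have cl : - ln y @[y --> rebased w (E a) (E b)] --> - ln (rebased w (E a) (E b)).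
    by apply: cvgN; apply: continuous_ln; exact: reb0.
  have [e e0 he] := nbhs_EFin_dist gB.
  have : \forall y \near rebased w (E a) (E b),
      `|- ln (rebased w (E a) (E b)) - - ln y| <= e by move/cvgrPdist_le: cl; apply.
  move=> /nbhs_ballP[e1 /= e10 he1].
  have e12 : 0 < e1 / 2 by lra.
  have [r hr] := gromov_rebased_cvg w (hE a) (hE b) e12.
  exists r => u v nu nv; apply: he.
  have := he1 (expR (- gp w u v)); rewrite expRK opprK distrC; apply.
  by have := hr u v nu nv; rewrite /ball/= distrC; lra.
Qed.

Lemma tight_span_bc : bc_hyperbolic_space M.
Proof.
split.
- exact: tight_span_proper.
- exact: tight_span_geodesic.
- exact: tight_span_complete.
- exists (2 * `|2 * ln (2 * K)|); first by rewrite mulr_ge0.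
  apply: four_point_thin => // x y z w; have := ler_norm (2 * ln (2 * K)).
  by have [h|h] := H4 x y z w => le; [left|right]; lra.
- exact: tight_span_boundary_continuous.
Qed.

Lemma near_ray_ideal_nbhd w a c r : rays_to a c ->
  \forall t \near +oo, ideal_nbhd w a r (Inner (c t)).
Proof. by move=> ac; exact: (ray_cvg ac (nbhs_ideal_nbhd w a r H4)). Qed.

Lemma visual_tight_span w a b xi eta : end_at a xi -> end_at b eta ->
  visual w a b = rebased w xi eta.
Proof.
move=> ax bx; have [c ac] := rays_to_ex a; have [c' bc'] := rays_to_ex b.
apply: (real_cvg_eq (visual_cvg tight_span_boundary_continuous w ac bc')).
apply/cvgrPdist_le => e e0; have [r hr] := gromov_rebased_cvg w ax bx e0.
near=> t; rewrite distrC; apply: hr; near: t; exact: near_ray_ideal_nbhd.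
Unshelve. all: by end_near. Qed.

Lemma busemann_tight_span w u b xi c : end_at b xi -> rays_to b c ->
  mdist u (c t) - mdist w (c t) @[t --> +oo] --> u xi - w xi.
Proof.
move=> bx bc; apply/cvgrPdist_le => e e0; have [r hr] := mdist_end_cvg w u bx e0.
near=> t; rewrite distrC; apply: hr; near: t; exact: near_ray_ideal_nbhd.
Unshelve. all: by end_near. Qed.

(** [visual w] and [rho] are comparable up to constants, and each of the two
    topologies is generated by the balls of the corresponding function. *)
Lemma end_homeomorphism (w : M) (E : boundary M -> Z) :
  (forall a, end_at a (E a)) -> homeomorphism E.
Proof.
move=> hE; have bcM := tight_span_boundary_continuous.
have [C wC] := bounded_tight w.
have wb z : - C <= w z <= C by have := wC z; rewrite ler_norml.
have v1 a b : rho (E a) (E b) <= expR C * visual w a b.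
  rewrite (visual_tight_span w (hE a) (hE b)) /rebased mulrA -expRD.
  rewrite -[leLHS]mul1r ler_wpM2r// -[leLHS]expR0 ler_expR.
  by have /andP[] := wb (E a); have /andP[] := wb (E b); lra.
have v2 a b : visual w a b <= expR C * rho (E a) (E b).
  rewrite (visual_tight_span w (hE a) (hE b)) /rebased ler_wpM2r// ler_expR.
  by have /andP[] := wb (E a); have /andP[] := wb (E b); lra.
split.
  move=> a B /rho_nbhs[e e0 he].
  have cv : visual w a b @[b --> a] --> visual w a a.
    have cp : (a, b) @[b --> a] --> (a, a).
      exact: (@cvg_pair _ _ _ _ (nbhs a) (nbhs a) _ _ _ _ _ (@cvg_cst _ a _ (nbhs a) _) cvg_id).
    exact: (cvg_comp _ _ cp (@visual_continuous _ _ bcM w (a, a))).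
  have v0 : visual w a a = 0 by apply/(visual_eq0 bcM w a a H4).
  have ec : 0 < expR (- C) * e by rewrite mulr_gt0 ?expR_gt0.
  have : \forall b \near a, visual w a b < expR (- C) * e.
    by apply: (cvgr_lt _ cv); rewrite v0.
  apply: filterS => b hb; apply: he; apply: le_lt_trans (v1 a b) _.
  by rewrite mulrC -ltr_pdivlMr ?expR_gt0// -expRN mulrC.
have [h hh] : {h : Z -> boundary M | forall xi, end_at (h xi) xi}.
  exists (fun xi => sval (cid (end_at_surj w xi))) => xi.
  exact: svalP (cid (end_at_surj w xi)).
have Eh xi : E (h xi) = xi.
  have [c ac] := rays_to_ex (h xi).
  exact: endpoint_eq (asymptotic_refl c) (hE _ _ ac) (hh _ _ ac).
exists h; split => // [a|xi].
  by apply: (@end_at_inj _ _ (E a)) => //; exact: hE.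
move=> B; rewrite nbhsE => -[_ [[W [oWi oW] <-] Wh] WB].
have [r hr] := oW (h xi) Wh w.
have e0 : 0 < expR (- C) * expR (- r) by rewrite mulr_gt0 ?expR_gt0.
have : \forall eta \near xi, rho xi eta < expR (- C) * expR (- r).
  have cr : rho xi eta @[eta --> xi] --> rho xi xi by exact: (continuous_rho_slice arho).
  by apply: (cvgr_lt _ cr); rewrite (separating_eq0 _ srho).
apply: filterS => eta heta; apply/WB/hr/(visual_le_gromov bcM).
apply: le_lt_trans (v2 _ _) _; rewrite !Eh.
by rewrite mulrC -ltr_pdivlMr ?expR_gt0// -expRN mulrC.
Qed.

End Ends.

(** * Antipodal functions as points of the tight span *)

Lemma sup_range_attained (R : realType) (T : Type) (f : T -> R) x :
  (forall y, f y <= f x) -> sup (range f) = f x.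
Proof.
move=> h; apply/eqP; rewrite eq_le; apply/andP; split.
  by apply: ge_sup => [|_ [y _ <-]//]; exists (f x), x.
by apply: ub_le_sup; [exists (f x) => _ [y _ <-]|exists x].
Qed.

Lemma pair_sums_eq (R : realType) (T : eqType) (f g : T -> R) :
  (forall x y : T, exists2 z, z != x & z != y) ->
  (forall x y, x != y -> f x + f y = g x + g y) -> forall x, f x = g x.
Proof.
move=> three h x; have [a ax _] := three x x; have [b bx ba] := three x a.
have h1 := h x a; have h2 := h x b; have h3 := h a b.
rewrite eq_sym in ax; rewrite eq_sym in bx; rewrite eq_sym in ba.
by move: (h1 ax) (h2 bx) (h3 ba); lra.
Qed.

Section MoebiusTight.
Context {R : realType} {Z : topologicalType}.
Variable rho : Z -> Z -> R.
Hypothesis arho : antipodal rho.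
Hypothesis cZ : compact [set: Z].
Hypothesis three : forall xi eta : Z, exists2 zeta, zeta != xi & zeta != eta.

Let srho : separating rho. Proof. by have [] := arho. Qed.
Let two xi : exists eta : Z, eta != xi. Proof. by have [eta] := three xi xi; exists eta. Qed.

Lemma moebius_space_tight rho' : moebius_space rho rho' -> exists u : tight_span rho,
  forall xi eta, rho' xi eta = expR (- (u xi + u eta) / 2) * rho xi eta.
Proof.
move=> [ar' eq]; have [sr' _ anti'] := ar'.
have [u cu uE] := log_derivative_exists three srho sr' eq.
have bu : exists C, bounded_by C u.
  have [x hx] : exists x, forall y, `|u y| <= `|u x|.
    by apply: (compact_max arho cZ) => x; apply: cvg_norm; exact: cu.
  by exists `|u x|.
have key xi eta : xi != eta -> ln (rho' xi eta) = - (u xi + u eta) / 2 + ln (rho xi eta).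
  by move=> ne; rewrite uE lnM ?expRK// ?posrE ?expR_gt0// separating_gt0.
suff tu : tight rho u by exists (TightSpan tu).
split => //.
- move=> xi eta ne; have := key _ _ ne; have : ln (rho' xi eta) <= 0.
    by rewrite -ln1 ler_ln ?posrE ?(separating_gt0 sr' ne)// antipodal_le1.
  by rewrite /logsq; lra.
- move=> xi e e0; have [eta r1] := anti' xi.
  have ne : xi != eta.
    by apply/eqP => xe; move: r1; rewrite xe (separating_eq0 _ sr') => /esym/eqP; rewrite oner_eq0.
  exists eta; first by rewrite eq_sym.
  by have := key _ _ ne; rewrite r1 ln1 /logsq; lra.
Qed.

(** Start from an admissible function with the prescribed sum, large at all other
    points; the retraction can only decrease the sum, and admissibility keeps it. *)
Lemma tight_through xi eta : xi != eta ->
  exists v : tight_span rho, v xi + v eta = logsq rho xi eta.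
Proof.
move=> ne; pose p := logsq rho xi eta.
have p0 : p <= 0 by exact: logsq_le0.
have rC : forall x y, rho x y = rho y x by case: srho.
pose h z := if z == eta then 0 else if z == xi then p else - p.
have ah : admissible rho h.
  move=> x y nxy; have l0 := logsq_le0 arho nxy; rewrite /h.
  case: (eqVneq x eta) => [xe|_]; case: (eqVneq y eta) => [ye|_].
  - by rewrite xe ye eqxx in nxy.
  - by case: (eqVneq y xi) => [yx|_]; [rewrite xe yx (logsqC rC) add0r|lra].
  - by case: (eqVneq x xi) => [xx|_]; [rewrite xx ye addr0|lra].
  - case: (eqVneq x xi) => [xx|_]; case: (eqVneq y xi) => [yx|_]; try lra.
    by rewrite xx yx eqxx in nxy.
have t0 := tight_zero arho.
have tr : tight rho (retract rho h).
  apply: (retract_tight rC two (u := TightSpan t0) (r := - p) ah) => z /=.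
  by rewrite subr0 /h ler_norml; case: ifP => _; [lra|case: ifP => _; lra].
exists (TightSpan tr); apply/eqP; rewrite eq_le; apply/andP; split => /=; last first.
  by have [_ ar _] := tr; exact: ar.
have := retract_le rC two xi ah; have := retract_le rC two eta ah.
rewrite /h eqxx (negbTE ne) eqxx -/p; lra.
Qed.

End MoebiusTight.

(** * Boundary continuous hyperbolic spaces *)

Section Space.
Context {R : realType} {X : metricType R}.
Implicit Types (x y z w : X) (c : R -> X) (k r s t : R) (a b : boundary X).
Local Notation d := (@mdist R X).
Local Notation gp := gromov_product.
Hypothesis hX : bc_hyperbolic_space X.
Hypothesis h4 : exists a b c d : boundary X, uniq [:: a; b; c; d].

Let pX : proper_space X. Proof. by case: hX. Qed.
Let gX : geodesic_space X. Proof. by case: hX. Qed.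
Let cX : geodesically_complete X. Proof. by case: hX. Qed.
Let bcX : boundary_continuous X. Proof. by case: hX. Qed.
Let three := third_point h4.

Lemma space_four_point : exists k, four_point (X := X) k.
Proof.
have [_ _ _ [D D0 thin] _] := hX.
by exists (6 * D + 4); exact: thin_four_point.
Qed.

Lemma boundary_point : exists a : boundary X, True.
Proof. by have [a _] := h4; exists a. Qed.

Lemma visual_antipodal x : antipodal (visual x).
Proof.
have [k H] := space_four_point.
have anti a : exists b, visual x a b = 1 by exact: (visual_antipode bcX x a pX gX cX H).
split => //.
  split.
  - exact: visual_continuous.
  - by move=> a b; exact: visual_ge0.
  - by move=> a b; exact: visual_sym.
  - by move=> a b; exact: visual_eq0 H.
have [a _] := boundary_point; have [b ab] := anti a.
rewrite -ab; apply: (@sup_range_attained _ _ (fun p => visual x p.1 p.2) (a, b)).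
by move=> p /=; rewrite ab visual_le1.
Qed.

Lemma visual_separating x : separating (visual x).
Proof. by have [] := visual_antipodal x. Qed.

Lemma visual_rescale x y a b : visual y a b =
  expR (- (- busemann x y a + - busemann x y b) / 2) * visual x a b.
Proof. by rewrite (visual_busemann bcX x) -expRD; congr (expR _ * _); field. Qed.

Lemma visual_moebius x y : moebius_space (visual x) (visual y).
Proof.
split; first exact: visual_antipodal.
exact: (moebius_equiv_rescale (visual_separating x) (visual_rescale x y)).
Qed.

Lemma visual_isometric x y : moebius_dist (visual x) (visual y) = d x y.
Proof.
have cB : continuous (fun a => - busemann x y a).
  by move=> a; exact: (cvgN (@busemann_continuous _ _ bcX x y a)).
rewrite (moebius_dist_eq three (visual_separating x) cB (visual_rescale x y)).
have [a ha] := busemann_max bcX x y gX cX.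
rewrite (@sup_range_attained _ _ _ a); rewrite normrN ha ger0_norm ?mdist_ge0//.
by move=> b; rewrite normrN busemann_le.
Qed.

Lemma visual_inj x y : visual x = visual y -> x = y.
Proof.
move=> xy; apply: mdist_positivity.
by rewrite -visual_isometric -xy visual_isometric mdistxx.
Qed.

Lemma visual_compact x : compact [set: boundary X].
Proof. have [k H] := space_four_point; exact: boundary_compact x pX gX H. Qed.

Lemma visual_ratio x : exists2 K, 0 < K & forall a b e f,
  visual x a b * visual x e f <=
  K * (visual x a e * visual x b f + visual x a f * visual x b e).
Proof.
have [k H] := space_four_point; exists (expR (k / 2)); first exact: expR_gt0.
by move=> a b e f; exact: visual_four_point.
Qed.

Lemma ideal_nbhd_visual x a b r : ideal_nbhd x a r (Ideal b) -> visual x a b <= expR (- r).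
Proof.
move=> [c [c' [ac bc [T hT]]]]; apply: (cvgr_to_le (visual_cvg bcX x ac bc)).
near=> t; rewrite ler_expR lerN2.
have Tt : T <= t by near: t; apply: nbhs_pinfty_ge; exact: num_real.
exact: hT.
Unshelve. all: by end_near. Qed.

Lemma ideal_nbhd_busemann x y a r :
  ideal_nbhd x a r (Inner y) -> r <= (d x y + busemann x y a) / 2.
Proof.
move=> [c [c' [ac c'y [T hT]]]].
have : 2 * r - d x y <= busemann x y a; last lra.
apply: (cvgr_to_ge (busemann_cvg bcX x y ac)); near=> t.
have Tt : T <= t by near: t; apply: nbhs_pinfty_ge; exact: num_real.
have := hT t t Tt Tt; rewrite c'y /gromov_product (metric_sym (c t)); lra.
Unshelve. all: by end_near. Qed.

(** Along an ultrafilter, points [x_n] of the segments between two rays, chosen at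
    the height prescribed by [u], converge to a point where the visual function
    agrees with [u] at the two ends; every other end sees it within [2 * delta],
    because one of the two remaining sides of an ideal triangle passes nearby. *)
Lemma visual_dense o delta (u : tight_span (visual o)) : 0 <= delta ->
  all_triangles_thin X delta ->
  exists x, forall a, `|u a + busemann o x a| <= 2 * delta.
Proof.
move=> delta0 thin; have [k H] := space_four_point.
have ao := visual_antipodal o; have so := visual_separating o.
have cZ := visual_compact o.
have [xi _] := boundary_point.
have [eta ne hu] := tight_attained ao cZ xi (tightP u).
have from b : exists c, [/\ geodesic_ray c, c 0 = o & rays_to b c].
  have [c0 bc0] := rays_to_ex b.
  have [c [rc c0x cc0]] := ray_from_point o pX gX H (rays_to_ray bc0).
  exists c; split => //; exact: rays_to_trans bc0 rc (asymptotic_sym cc0).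
have [c [rc c0 xc]] := from xi; have [c' [rc' c'0 ec']] := from eta.
have [U UU sU] := ultra_infty.
have cvgU : n%:R @[n --> U] --> (+oo : set_system R).
  apply: cvg_trans (cvgr_idn (R := R)) => A; exact: sU.
have vpos := separating_gt0 so ne.
(* As [visual o xi eta] is positive, the products along the two rays stay bounded. *)
pose g0 := - ln (visual o xi eta / 2).
have gb : \forall n \near U, gp o (c n%:R) (c' n%:R) <= g0.
  have cv : expR (- gp o (c n%:R) (c' n%:R)) @[n --> U] --> visual o xi eta.
    exact: (cvg_comp _ _ cvgU (visual_cvg bcX o xc ec')).
  have : \forall n \near U, visual o xi eta / 2 < expR (- gp o (c n%:R) (c' n%:R)).
    by apply: (cvgr_gt _ cv); lra.
  apply: filterS => n; rewrite -[ltLHS]lnK ?posrE ?divr_gt0// ltr_expR /g0; lra.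
have dn (n : nat) : d o (c n%:R) = n%:R by rewrite -c0 (ray_dist rc)// subr0.
have dn' (n : nat) : d o (c' n%:R) = n%:R by rewrite -c'0 (ray_dist rc')// subr0.
(* The prescribed height lies on the segment only for large [n]; see [bnd]. *)
have seg (n : nat) : {p : X * set X | geodesic_segment (c n%:R) (c' n%:R) p.2 /\
    (0 <= n%:R + u xi <= d (c n%:R) (c' n%:R) -> p.2 p.1 /\ d (c n%:R) p.1 = n%:R + u xi)}.
  apply: cid; have [S sS] := gX (c n%:R) (c' n%:R); have [l [il l0 ll SE]] := sS.
  exists (l (n%:R + u xi), S); split => // bnd; split.
    by rewrite SE; exists (n%:R + u xi); rewrite //= in_itv.
  rewrite -{1}l0 il; first by rewrite sub0r normrN ger0_norm//; case/andP: bnd.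
    by rewrite /= in_itv/= lexx mdist_ge0.
  by rewrite /= in_itv.
pose x_ n := (sval (seg n)).1.
have bnd : \forall n \near U, 0 <= n%:R + u xi <= d (c n%:R) (c' n%:R).
  near=> n.
  have h1 : gp o (c n%:R) (c' n%:R) <= g0 by near: n.
  have h2 : `|u xi| + 2 * g0 <= n%:R by near: n; exact: near_ultra_ger.
  have h3 := ler_norm (u xi); have h4' := ler_norm (- u xi); rewrite normrN in h4'.
  have h5 : `|u xi| <= n%:R by near: n; exact: near_ultra_ger.
  move: h1; rewrite /gromov_product dn dn'; lra.
have xS : \forall n \near U, (sval (seg n)).2 (x_ n) /\ d (c n%:R) (x_ n) = n%:R + u xi.
  by apply: filterS bnd => n bn; have [_] := svalP (seg n); apply.
have xb : \forall n \near U, d o (x_ n) <= `|u xi| + 2 * `|g0| + `|k|.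
  near=> n.
  have [Sx dx] : (sval (seg n)).2 (x_ n) /\ d (c n%:R) (x_ n) = n%:R + u xi by near: n.
  have [sg _] := svalP (seg n); have [e1 _ _] := segment_between sg Sx.
  have h1 : gp o (c n%:R) (c' n%:R) <= g0 by near: n.
  have h3 := ler_norm (u xi); have h4' := ler_norm (- u xi); rewrite normrN in h4'.
  have h6 := ler_norm g0; have h7 := ler_norm k.
  have h8 := normr_ge0 (u xi); have h9 := normr_ge0 g0.
  have s1 := metric_sym (x_ n) (c n%:R).
  have := H o (x_ n) (c n%:R) (c' n%:R); move: h1; rewrite /gromov_product dn dn'.
  by move=> h1 [] h2; lra.
have [x cx] := bounded_ultra_cvg pX UU xb.
have dx0 : d (x_ n) x @[n --> U] --> (0 : R).
  by rewrite -(mdistxx x); exact: (cvg_mdist cx (@cvg_cst _ x _ U _)).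
have close e : 0 < e -> \forall n \near U, d (x_ n) x <= e.
  by move=> e0; apply: (cvgr_le _ dx0).
have Bxi : busemann o x xi = - u xi.
  have cB : d o (c n%:R) - d x (c n%:R) @[n --> U] --> busemann o x xi.
    exact: (cvg_comp _ _ cvgU (busemann_cvg bcX o x xc)).
  apply: (real_cvg_eq cB); apply/cvgrPdist_le => e e0; near=> n.
  have [_ dx] : (sval (seg n)).2 (x_ n) /\ d (c n%:R) (x_ n) = n%:R + u xi by near: n.
  have : d (x_ n) x <= e by near: n; exact: close.
  have := metric_triangle (c n%:R) (x_ n) x; have := metric_triangle (c n%:R) x (x_ n).
  by rewrite dn (metric_sym x (x_ n)) (metric_sym x (c n%:R)) ler_norml; lra.
have gcl b b' f f' : rays_to b f -> rays_to b' f' ->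
    forall r, (\forall n \near U, gp (x_ n) (f n%:R) (f' n%:R) <= r) ->
    expR (- r) <= visual x b b'.
  move=> bf bf' r hr; apply/ler_addgt0Pr => e e0.
  have cv : expR (- gp x (f n%:R) (f' n%:R)) @[n --> U] --> visual x b b'.
    exact: (cvg_comp _ _ cvgU (visual_cvg bcX x bf bf')).
  have ce : expR (- r - t) @[t --> (0 : R)] --> expR (- r).
    have : (fun t : R => expR (- r - t)) @ (0 : R) --> expR (- r - 0).
      apply: continuous_cvg; first exact: continuous_expR.
      by apply: cvgB; [exact: cvg_cst|exact: cvg_id].
    by rewrite subr0.
  have : \forall t \near (0 : R), `|expR (- r) - expR (- r - t)| <= e.
    by move/cvgrPdist_le: ce; apply.
  move=> /nbhs_ballP[e1 /= e10 he1].
  have := he1 (e1 / 2); rewrite /ball/= sub0r normrN ger0_norm; last lra.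
  move=> /(_ ltac:(lra)); rewrite ler_norml => /andP[_ he].
  have e12 : 0 < e1 / 2 by lra.
  suff : expR (- r - e1 / 2) <= visual x b b' by lra.
  apply: (cvgr_to_ge cv); near=> n; rewrite ler_expR.
  have h1 : gp (x_ n) (f n%:R) (f' n%:R) <= r by near: n.
  have h2 : d (x_ n) x <= e1 / 2 by near: n; exact: close.
  by have := gromov_product_base (x_ n) x (f n%:R) (f' n%:R); rewrite ler_norml; lra.
have rel a b : visual x a b = expR ((busemann o x a + busemann o x b) / 2) * visual o a b.
  by rewrite (visual_busemann bcX o) -expRD; congr (expR _ * _); field.
have ln_rel a b : a != b ->
    ln (visual x a b) = (busemann o x a + busemann o x b + logsq (visual o) a b) / 2.
  move=> nab; rewrite rel lnM ?expRK ?posrE ?expR_gt0// ?separating_gt0// /logsq; lra.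
have Beta : busemann o x eta = - u eta.
  have v1 : visual x xi eta = 1.
    apply/eqP; rewrite eq_le visual_le1//= -expR0 -oppr0; apply: (gcl _ _ _ _ xc ec').
    near=> n.
    have [Sx _] : (sval (seg n)).2 (x_ n) /\ d (c n%:R) (x_ n) = n%:R + u xi by near: n.
    have [sg _] := svalP (seg n).
    by have := gromov_product_le_segment (x_ n) sg Sx; rewrite mdistxx.
  by have := ln_rel _ _ ne; rewrite v1 ln1 Bxi -hu; lra.
have lower a : - (2 * delta) <= u a + busemann o x a.
  have [e [re e0 ae]] := from a.
  have [h|h] : expR (- delta) <= visual x eta a \/ expR (- delta) <= visual x a xi.
    (* The choice of the nearby side may depend on [n], but the ultrafilter decides. *)
    pose Q := [set n : nat | gp (x_ n) (c' n%:R) (e n%:R) <= delta].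
    have or : \forall n \near U, gp (x_ n) (c' n%:R) (e n%:R) <= delta \/
        gp (x_ n) (e n%:R) (c n%:R) <= delta.
      apply: filterS xS => n [Sx _]; have [sg _] := svalP (seg n).
      have [B sB] := gX (c' n%:R) (e n%:R); have [C sC] := gX (e n%:R) (c n%:R).
      have [/(_ _ Sx)[q [Bq|Cq] qd] _ _] := thin _ _ _ _ _ _ sg sB sC.
        by left; exact: le_trans (gromov_product_le_segment _ sB Bq) qd.
      by right; exact: le_trans (gromov_product_le_segment _ sC Cq) qd.
    have [UQ|UQ] := in_ultra_setVsetC Q UU.
      by left; exact: (gcl _ _ _ _ ec' ae).
    right; apply: (gcl _ _ _ _ ae xc); apply: filterS2 or UQ => n [nq|//] nQ.
    by exfalso; exact: nQ.
  - have nea : eta != a.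
      apply: contraTneq h => <-; rewrite separating_eq0 -?ltNge ?expR_gt0//.
      exact: visual_separating.
    have := ln_rel _ _ nea; have [_ au _] := tightP u; have := au _ _ nea.
    have : - delta <= ln (visual x eta a).
      by rewrite -ler_expR lnK// posrE separating_gt0//; exact: visual_separating.
    by rewrite Beta; lra.
  - have nea : a != xi.
      apply: contraTneq h => ->; rewrite separating_eq0 -?ltNge ?expR_gt0//.
      exact: visual_separating.
    have := ln_rel _ _ nea; have [_ au _] := tightP u; have := au _ _ nea.
    have : - delta <= ln (visual x a xi).
      by rewrite -ler_expR lnK// posrE separating_gt0//; exact: visual_separating.
    by rewrite Bxi; lra.
exists x => a; rewrite ler_norml lower/=.
have [b nab hab] := tight_attained ao cZ a (tightP u).
have := lower b; have := ln_rel _ _ nab.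
have : ln (visual x a b) <= 0.
  rewrite -ln1 ler_ln ?posrE ?visual_le1// separating_gt0//; exact: visual_separating.
lra.
Unshelve. all: by end_near. Qed.

End Space.

(** * Extending Moebius maps *)

Section Transport.
Context {R : realType} {X Y : metricType R}.
Variable g : boundary Y -> boundary X.
Hypotheses (hX : bc_hyperbolic_space X) (hY : bc_hyperbolic_space Y).
Hypothesis h4 : exists a b c d : boundary X, uniq [:: a; b; c; d].
Hypotheses (homeo_g : homeomorphism g) (moebius_g : moebius_map g).
Local Notation gp := gromov_product.

Let bcX : boundary_continuous X. Proof. by case: hX. Qed.
Let bcY : boundary_continuous Y. Proof. by case: hY. Qed.

Lemma boundary_points_transport : exists a b c d : boundary Y, uniq [:: a; b; c; d].
Proof.
have [_ [h [gK hK _]]] := homeo_g; have [a [b [c [d un]]]] := h4.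
exists (h a), (h b), (h c), (h d).
by have := map_inj_uniq (can_inj hK) [:: a; b; c; d]; rewrite un.
Qed.

Let h4Y := boundary_points_transport.

Lemma moebius_space_transport (o : X) (y : Y) (h : boundary X -> boundary Y) :
  cancel g h -> cancel h g -> continuous h ->
  moebius_space (visual o) (fun a b => visual y (h a) (h b)).
Proof.
move=> gK hK ch; have [sy s1 anti] := visual_antipodal hY h4Y y.
have [_ ge0 sym eq0] := sy.
split; last first.
  move=> a a' b b' un; have := moebius_g y o (xi := h a) (xi' := h a') (eta := h b) (eta' := h b').
  rewrite !hK => -> //.
  by have := map_inj_uniq (can_inj hK) [:: a; a'; b; b']; rewrite un.
split.
- split => // [[a b]|a b].
    have c1 : h p.1 @[p --> (a, b)] --> h a.
      exact: (cvg_comp _ _ (@cvg_fst _ _ (nbhs a) (nbhs b) _) (ch a)).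
    have c2 : h p.2 @[p --> (a, b)] --> h b.
      exact: (cvg_comp _ _ (@cvg_snd _ _ (nbhs a) (nbhs b) _) (ch b)).
    exact: (separating_cvg sy c1 c2).
  by split => [/eq0/(can_inj hK)//|->]; apply/eq0.
- rewrite -[RHS]s1; congr sup; apply/seteqP; split => _ [[a b] _ <-] /=.
    by exists (h a, h b).
  by exists (g a, g b); rewrite //= !gK.
- move=> a; have [b hb] := anti (h a); exists (g b); by rewrite gK.
Qed.

(** A map that realizes the visual functions of [Y] as visual functions of [X]
    carries along Busemann functions, hence distances and neighbourhoods at
    infinity. *)
Lemma extension_of_visual (G : Y -> X) :
  (forall y a b, visual (G y) (g a) (g b) = visual y a b) ->
  isometric_embedding G /\ continuous (extended_map G g).
Proof.
move=> GE; have [cg [h [gK hK ch]]] := homeo_g.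
have busG y z a : busemann (G y) (G z) (g a) = busemann y z a.
  move: a; apply: (pair_sums_eq (third_point h4Y)) => a b ab.
  have e1 := visual_busemann bcX (G y) (G z) (g a) (g b).
  have e2 := visual_busemann bcY y z a b.
  have v0 : visual y a b != 0.
    by rewrite gt_eqF// separating_gt0//; exact: visual_separating.
  move: e1; rewrite !GE e2 => /(mulIf v0); rewrite -!expRD => /expR_inj; lra.
have iso : isometric_embedding G.
  move=> y z; have [_ gX cX _ _] := hX; have [_ gY cY _ _] := hY.
  apply/eqP; rewrite eq_le; apply/andP; split.
    have [a <-] := busemann_max bcX (G y) (G z) gX cX.
    by rewrite -(hK a) busG (le_trans (ler_norm _))// busemann_le.
  have [a <-] := busemann_max bcY y z gY cY.
  by rewrite -busG (le_trans (ler_norm _))// busemann_le.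
split => //; apply: compactification_continuous.
  move=> y B; have := @Inner_continuous _ X (G y).
  have cG : G z @[z --> y] --> G y.
    apply/metricType_numDomainType.cvgrPdist_lt => e e0.
    by apply/nbhs_ballP; exists e => // z; rewrite ballEmdist /= iso.
  by move=> cI; exact: (cvg_comp _ _ cG cI).
move=> a B; rewrite nbhsE => -[U [[_ oU] Ua] UB].
have [c ac] := rays_to_ex a; pose y0 := c 0.
have [r hr] := oU (g a) Ua (G y0); exists y0, (r + 1) => -[y|b] /= nz; apply/UB/hr.
  apply: (ideal_nbhd_inner bcX); rewrite iso busG.
  by have := ideal_nbhd_busemann hY nz; lra.
apply: (visual_le_gromov bcX); rewrite GE; apply: le_lt_trans (ideal_nbhd_visual hY nz) _.
by rewrite ltr_expR; lra.
Qed.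

End Transport.

(** * Maximal spaces *)

Section Fill.
Context {R : realType} {X : metricType R}.
Variable o : X.
Hypothesis hX : bc_hyperbolic_space X.
Hypothesis h4 : exists a b c d : boundary X, uniq [:: a; b; c; d].
Local Notation rho := (visual o).
Local Notation M := (tight_span rho).

Let bcX : boundary_continuous X. Proof. by case: hX. Qed.
Let three := third_point h4.
Let arho : antipodal rho := visual_antipodal hX h4 o.
Let srho : separating rho := visual_separating hX h4 o.
Let cZ : compact [set: boundary X] := visual_compact hX o.

(** The Busemann cocycle of [G] at the end [a] equals the difference of the values
    at [a], so [G u] has visual function [u] up to an additive error depending on
    [a] only; joining two ends by a geodesic line of the span shows that the
    errors at any two ends cancel, so that they vanish. *)
Lemma visual_of_extension (E : boundary M -> boundary X) (G : M -> X) :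
  (forall a, end_at a (E a)) -> isometric_embedding G -> continuous (extended_map G E) ->
  forall (u : M) a b, visual (G u) a b = expR (- (u a + u b) / 2) * rho a b.
Proof.
move=> hE iG cG; have [K K0 hK] := visual_ratio hX o.
have rayG e c : rays_to e c -> rays_to (E e) (G \o c).
  move=> ec; have rc := rays_to_ray ec.
  have rGc : geodesic_ray (G \o c) by move=> s t s0 t0; rewrite /= iG; exact: rc.
  have [b bGc] := boundary_of_ray rGc; suff -> : E e = b by [].
  have c1 : Inner (G (c t)) @[t --> +oo] --> (Ideal (E e) : compactification X).
    exact: (cvg_comp _ _ (ray_cvg ec) (cG (Ideal e))).
  have gx := gromov_product_extP bcX o; have [cg g0 _] := gx.
  have lim z : Inner (G (c t)) @[t --> +oo] --> z ->
      expNe (gromov_product_ext o (Ideal (E e), Inner (G (c t)))) @[t --> +oo] -->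
      expNe (gromov_product_ext o (Ideal (E e), z)).
    move=> cz; apply: cvg_expNe; first exact: g0.
    have h : (Ideal (E e), Inner (G (c t))) @[t --> +oo] -->
        (Ideal (E e) : compactification X, z).
      exact: (@cvg_pair _ _ _ _ (nbhs (Ideal (E e) : compactification X)) (nbhs z)
        _ _ _ _ _ (cvg_cst _) cz).
    exact: (cvg_comp _ _ h (cg _)).
  have v0 : rho (E e) b = 0.
    rewrite -(separating_eq0 (E e) srho).
    exact: (real_cvg_eq (lim _ (ray_cvg bGc)) (lim _ c1)).
  by have [_ _ _ eq0] := srho; apply/eq0.
have surj xi : exists e, E e = xi.
  have [e ex] := end_at_surj arho cZ three (TightSpan (tight_zero arho)) xi.
  exists e; have [c ec] := rays_to_ex e.
  exact: (endpoint_eq arho (asymptotic_refl c) (hE _ _ ec) (ex _ ec)).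
have bus (u v : M) xi : busemann (G u) (G v) xi = u xi - v xi.
  have [e <-] := surj xi; have [c ec] := rays_to_ex e.
  apply: (real_cvg_eq (busemann_cvg bcX (G u) (G v) (rayG _ _ ec))).
  have lim : mdist u (c t) - mdist v (c t) @[t --> +oo] --> u (E e) - v (E e).
    exact: (busemann_tight_span arho cZ K0 hK (hE e) ec).
  by under eq_fun do rewrite /= !iG.
pose z0 : M := TightSpan (tight_zero arho).
pose k xi := - busemann o (G z0) xi.
have ku u xi : - busemann o (G u) xi = k xi + u xi.
  by rewrite (busemann_cocycle bcX o (G z0)) bus /k /=; lra.
have k0 xi : k xi = 0.
  move: xi; apply: (pair_sums_eq three (g := fun=> 0)) => xi eta ne.
  have [v hv] := tight_through arho three ne.
  have [c1 [r1 c10 c1x]] := tight_span_ray arho three v xi.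
  have [c2 [r2 c20 c2x]] := tight_span_ray arho three v eta.
  have toE c x : geodesic_ray c -> c 0 = v -> (forall t, 0 <= t -> c t x = v x - t) ->
      rays_to x (G \o c).
    move=> rc c0 cx; have [e ec] := boundary_of_ray rc.
    suff -> : x = E e by exact: rayG.
    apply: (endpoint_eq arho (asymptotic_refl c) _ (hE _ _ ec)) => t t0.
    by rewrite c0 cx.
  have v1 : visual (G v) xi eta = 1.
    apply: (real_cvg_eq (visual_cvg bcX (G v) (toE _ _ r1 c10 c1x) (toE _ _ r2 c20 c2x))).
    apply: cvg_near_cst; near=> t.
    have t0 : 0 <= t by near: t; apply: nbhs_pinfty_ge; exact: num_real.
    suff -> : gromov_product (G v) (G (c1 t)) (G (c2 t)) = 0 by rewrite oppr0 expR0.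
    apply/eqP; rewrite eq_le gromov_product_ge0 andbT /gromov_product !iG.
    have := ray_dist r1 (lexx 0) t0; have := ray_dist r2 (lexx 0) t0; rewrite c10 c20.
    have [_ a2 _] := tightP (c2 t); have := a2 _ _ ne; rewrite -hv.
    have := tight_mdist_ge (c2 t) (c1 t) xi; rewrite metric_sym c1x//.
    have := c2x t t0; lra.
  have := visual_rescale hX o (G v) xi eta; rewrite v1 !ku => /(congr1 (@ln R)).
  rewrite ln1 lnM ?expRK ?posrE ?expR_gt0//; last exact: separating_gt0.
  by move: hv; rewrite /logsq; lra.
by move=> u a b; rewrite (visual_rescale hX o) !ku !k0 !add0r.
Unshelve. all: by end_near. Qed.

(** The tight span is itself a boundary continuous hyperbolic space with the same
    Moebius boundary, so maximality embeds it in [X]. *)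
Lemma maximal_visual_surjective : maximal_hyperbolic X ->
  forall rho', moebius_space rho rho' -> exists x, visual x = rho'.
Proof.
move=> [_ maxX] rho' /(moebius_space_tight arho cZ three)[u uE].
have [K K0 hK] := visual_ratio hX o.
have ends := end_at_ex arho cZ.
have [E hE] : {E : boundary M -> boundary X | forall a, end_at a (E a)}.
  by exists (fun a => sval (cid (ends a))) => a; exact: svalP (cid (ends a)).
have homeoE := end_homeomorphism arho cZ three K0 hK u hE.
have moebE : moebius_map E.
  move=> w x xi xi' eta eta' un.
  have [_ [h [EK _ _]]] := homeoE.
  have unE : uniq [:: E xi; E xi'; E eta; E eta'].
    by have := map_inj_uniq (can_inj EK) [:: xi; xi'; eta; eta']; rewrite un.
  have [_ <-//] := visual_moebius hX h4 o x.
  rewrite (moebius_equiv_rescale srho (rho2 := rebased w) (u := w) (fun _ _ => erefl)) //.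
  by rewrite /cross_ratio !(visual_tight_span arho cZ K0 hK w (hE _) (hE _)).
have [G iG cG] := maxX M E (tight_span_bc arho cZ three K0 hK) homeoE moebE.
exists (G u); apply/funext => a; apply/funext => b.
by rewrite uE; exact: visual_of_extension.
Qed.

End Fill.

Theorem theorem1p4 (R : realType) (X : metricType R) (o : X) (delta : R)
    (hX : bc_hyperbolic_space X)
    (h4 : exists a b c d : boundary X, uniq [:: a; b; c; d])
    (hdelta : 0 <= delta) (hthin : all_triangles_thin X delta) :
  (forall rho, moebius_space (visual o) rho ->
     exists x : X, moebius_dist rho (visual x) <= 7 * delta) /\
  (((forall x y : X, moebius_dist (visual x) (visual y) = mdist x y) /\
    set_bij setT (moebius_space (visual o)) (@visual R X)) <->
   maximal_hyperbolic X).
Proof.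
have ao := visual_antipodal hX h4 o; have cZ := visual_compact hX o.
have three := third_point h4.
split.
  move=> rho rhoM; have [[sr _ _] _] := rhoM.
  have [u uE] := moebius_space_tight ao cZ three rhoM.
  have [x hx] := visual_dense hX h4 u hdelta hthin; exists x.
  (* Minus the logarithm of the derivative of [visual x] with respect to [rho]. *)
  pose v a := - (u a + busemann o x a).
  have cv : continuous v.
    have [_ _ _ _ bcX] := hX.
    move=> a; exact: (cvgN (cvgD (tight_continuous ao cZ (tightP u) (x := a))
      (@busemann_continuous _ _ bcX o x a))).
  have vE a b : visual x a b = expR (- (v a + v b) / 2) * rho a b.
    rewrite uE (visual_rescale hX o) mulrA -expRD; congr (expR _ * _).
    by rewrite /v; field.
  rewrite (moebius_dist_eq three sr cv vE).
  have [a _] := h4; apply: ge_sup => [|_ [b _ <-]]; first by exists `|v a|, a.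
  by rewrite normrN; apply: le_trans (hx b) _; lra.
split=> [[_ [_ _ surj]]|maxX].
  split => // Y g hY homeo_g moebius_g.
  have [_ [h [gK hK ch]]] := homeo_g.
  have ex y : {x : X | visual x = fun a b => visual y (h a) (h b)}.
    apply: cid; have [x _ xE] := surj _
      (moebius_space_transport hY h4 homeo_g moebius_g o y gK hK ch).
    by exists x.
  exists (fun y => sval (ex y)).
    apply: (proj1 (extension_of_visual hX hY h4 homeo_g _)) => y a b.
    by rewrite (svalP (ex y)) !gK.
  apply: (proj2 (extension_of_visual hX hY h4 homeo_g _)) => y a b.
  by rewrite (svalP (ex y)) !gK.
split; first exact: visual_isometric.
split.
- by move=> x _; exact: visual_moebius.
- by move=> x y _ _; exact: visual_inj.
- by move=> rho /(maximal_visual_surjective hX h4 maxX)[x xE]; exists x.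
Qed.
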